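(* Any c-parser $P$ with running time $O(T(g)\,t(n))$ on context-free grammars of size $g$ and strings of length $n$ can be converted into a Boolean matrix multiplication algorithm $M_P$ that computes the Boolean product of two $m\times m$ Boolean matrices in time $O\bigl(\max\bigl(m^2,\; T(m^2)\, t(m^{1/3})\bigr)\bigr)$. In particular, if $P$ takes time $O(g\,n^{3-\epsilon})$, then $M_P$ runs in time $O(m^{3-\epsilon/3})$.
   Context: A context-free grammar (CFG) is a 4-tuple $G=(\Sigma,V,R,S)$ with $\Sigma$ the set of terminals, $V$ the set of nonterminals, $R$ the set of productions, and $S\in V$ the start symbol; $\Rightarrow^*$ denotes the derivation relation (zero or more rewriting steps). The size $|G|$ of $G$ is the sum of the lengths of all productions in $R$. For a string $w=w_1w_2\cdots w_n$ with each $w_i\in\Sigma$, $w_i^j$ denotes the substring $w_iw_{i+1}\cdots w_j$ (the empty string when $j=i-1$). C-derivation: a nonterminal $A\in V$ c-derives $w_i^j$ (with respect to $G$ and $w$) if and only if $A\Rightarrow^* w_i^j$ and $S\Rightarrow^* w_1^{i-1}\,A\,w_{j+1}^n$. C-parser: an algorithm that takes as input a CFG $G=(\Sigma,V,R,S)$ and a string $w\in\Sigma^*$ and produces output $\mathcal{F}_{G,w}$ that acts as an oracle about parse information as follows. For any $A\in V$ and any substring $w_i^j$ of $w$: (1) if $A$ c-derives $w_i^j$, then $\mathcal{F}_{G,w}(A,i,j)=$ ''yes''; (2) if $A\not\Rightarrow^* w_i^j$, then $\mathcal{F}_{G,w}(A,i,j)=$ ''no''; (3) $\mathcal{F}_{G,w}$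 answers each query in constant time. (If $A\Rightarrow^* w_i^j$ but $A$ does not c-derive $w_i^j$, the answer may be arbitrary.) The running time of a c-parser is the time it takes to produce $\mathcal{F}_{G,w}$ from $G$ and $w$. Boolean matrix multiplication (BMM): a Boolean matrix has entries in $\{0,1\}$. A BMM algorithm takes as input two $m\times m$ Boolean matrices $A=(a_{ij})$ and $B=(b_{ij})$ and returns their Boolean product $C=(c_{ij})$, defined by $c_{ij}=\bigvee_{k=1}^m (a_{ik}\wedge b_{kj})$. *)

(* Defs.v *)
(* MathComp for grammars, matrices and the machine; the real numbers of Stdlib
   for running-time bounds. *)
From Stdlib Require Import Reals Relation_Operators.
From mathcomp Require Import all_boot.
From mathcomp Require Import matrix.

Set Implicit Arguments.
Unset Strict Implicit.
Unset Printing Implicit Defensive.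

(* The machine is a unit-cost word RAM. Its store consists of finitely many
   named arrays of natural numbers (only the names occurring in a program
   matter), every cell of which is 0 unless it belongs to the input; array names
   are program constants, indices are computed. Programs are finite structured
   texts, and each arithmetic operation, memory access, assignment and test
   costs one step. *)
Definition store := nat -> nat -> nat.

Definition upd (s : store) (a i v : nat) : store :=
  fun b j => if (b == a) && (j == i) then v else s b j.

Inductive binop :=
  Add | Sub | Mul | Div | Mod | Eqb | Ltb | And | Or | Xor | Shl | Shr.

(* Subtraction is truncated, and [x %/ 0 = 0], [x %% 0 = x]. *)
Definition binop_fun (o : binop) : nat -> nat -> nat :=
  match o with
  | Add => addn
  | Sub => subn
  | Mul => muln
  | Div => divn
  | Mod => modn
  | Eqb => fun x y => x == y
  | Ltb => fun x y => x < y
  | And => Nat.land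
  | Or => Nat.lor
  | Xor => Nat.lxor
  | Shl => fun x y => x * 2 ^ y
  | Shr => fun x y => x %/ 2 ^ y
  end.

Inductive expr :=
| Lit of nat
| Get of nat & expr
| Bin of binop & expr & expr.

Fixpoint ecost (e : expr) : nat :=
  match e with
  | Lit _ => 1
  | Get _ e1 => (ecost e1).+1
  | Bin _ e1 e2 => (ecost e1 + ecost e2).+1
  end.

Definition word (W v : nat) : option nat := if v <= W then Some v else None.

(* [W] is the largest number that fits in a machine word. A program that
   computes a larger number is stuck, so that it has no execution. *)
Fixpoint eval (W : nat) (s : store) (e : expr) : option nat :=
  match e with
  | Lit n => word W n
  | Get a e1 => if eval W s e1 is Some i then word W (s a i) else None
  | Bin o e1 e2 =>
      if eval W s e1 is Some x then
        if eval W s e2 is Some y then word W (binop_fun o x y) else None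
      else None
  end.

Inductive cmd :=
| Skip
| Put of nat & expr & expr
| Seq of cmd & cmd
| If of expr & cmd & cmd
| While of expr & cmd.

(* [exec W c s s' n]: with words bounded by [W], the program [c] started in [s]
   halts in [s'] after [n] steps. *)
Inductive exec (W : nat) : cmd -> store -> store -> nat -> Prop :=
| ExecSkip s : exec W Skip s s 1
| ExecPut a e1 e2 s i v :
    eval W s e1 = Some i -> eval W s e2 = Some v ->
    exec W (Put a e1 e2) s (upd s a i v) (ecost e1 + ecost e2).+1
| ExecSeq c1 c2 s s1 s2 n1 n2 :
    exec W c1 s s1 n1 -> exec W c2 s1 s2 n2 ->
    exec W (Seq c1 c2) s s2 (n1 + n2)
| ExecIfTrue e c1 c2 s s' v n :
    eval W s e = Some v -> v != 0 -> exec W c1 s s' n ->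
    exec W (If e c1 c2) s s' (n + ecost e).+1
| ExecIfFalse e c1 c2 s s' n :
    eval W s e = Some 0 -> exec W c2 s s' n ->
    exec W (If e c1 c2) s s' (n + ecost e).+1
| ExecWhileTrue e c s s1 s2 v n1 n2 :
    eval W s e = Some v -> v != 0 ->
    exec W c s s1 n1 -> exec W (While e c) s1 s2 n2 ->
    exec W (While e c) s s2 (n1 + n2 + ecost e).+1
| ExecWhileFalse e c s :
    eval W s e = Some 0 -> exec W (While e c) s s (ecost e).+1.

(* On an input of size [N], a computation of [n] steps uses words of
   O(log (N + n)) bits, i.e. numbers polynomially bounded in [N + n]; unbounded
   words at unit cost would be unreasonably powerful (they allow a whole matrix
   row to be packed into one word). *)
Definition max_word (k N n : nat) : nat := (N + n + 2) ^ k.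

Record cfg := Cfg {
  nonterms : nat;
  terms : nat;
  prods : seq ('I_nonterms * seq ('I_nonterms + 'I_terms));
  start : 'I_nonterms;
  _ : uniq prods
}.

Notation symbol G := ('I_(nonterms G) + 'I_(terms G))%type.

Section Derivations.
Variable G : cfg.
Implicit Types (A : 'I_(nonterms G)) (w : seq 'I_(terms G)).

(* The length of A -> alpha counts its left-hand side. *)
Definition cfg_size : nat := sumn [seq (size p.2).+1 | p <- prods G].

Inductive rewrites : seq (symbol G) -> seq (symbol G) -> Prop :=
| Rewrites u v p : p \in prods G -> rewrites (u ++ inl p.1 :: v) (u ++ p.2 ++ v).

Definition derives : seq (symbol G) -> seq (symbol G) -> Prop :=
  clos_refl_trans _ rewrites.

Definition tm : seq 'I_(terms G) -> seq (symbol G) := map inr.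

(* The substring w_i^j, with positions counted from 1. *)
Definition substr w (i j : nat) := drop i.-1 (take j w).

Definition is_substr w (i j : nat) : bool :=
  [&& 0 < i, i <= j.+1 & j <= size w].

Definition derives_sub w A i j : Prop := derives [:: inl A] (tm (substr w i j)).

Definition c_derives w A i j : Prop :=
  derives_sub w A i j /\
  derives [:: inl (start G)] (tm (take i.-1 w) ++ inl A :: tm (drop j w)).

End Derivations.

Definition symbol_code (G : cfg) (x : symbol G) : nat :=
  match x with inl A => A | inr a => nonterms G + a end.

Definition cfg_code (G : cfg) : seq nat :=
  [:: nonterms G; terms G; val (start G); size (prods G)] ++
  flatten [seq val p.1 :: size p.2 :: map (@symbol_code G) p.2 | p <- prods G].

(* A parser finds the grammar in array 0 and the string, preceded by its length,
   in array 1. *)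
Definition parser_input (G : cfg) (w : seq 'I_(terms G)) : store :=
  fun a x =>
    match a with
    | 0 => nth 0 (cfg_code G) x
    | 1 => nth 0 (size w :: map val w) x
    | _ => 0
    end.

Definition parser_input_size (G : cfg) (w : seq 'I_(terms G)) : nat :=
  nonterms G + terms G + cfg_size G + size w.

(* [prep] turns (G, w) into a store representing F_{G,w}; [query] then answers
   a query (A, i, j), which it finds in cells 0, 1, 2 of array 2, by writing 1
   or 0 into cell 0 of array 3. *)
Record parser := Parser { prep : cmd; query : cmd }.

Definition ask (s : store) (A i j : nat) : store :=
  upd (upd (upd s 2 0 A) 2 1 i) 2 2 j.

Definition answer (s : store) : nat := s 3 0.

(* The stores reachable from [s0] by sequences of queries: an oracle can be
   consulted any number of times. *)
Inductive consulted (W : nat) (Q : cmd) (G : cfg) (w : seq 'I_(terms G))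
    (s0 : store) : store -> Prop :=
| Consulted0 : consulted W Q w s0 s0
| ConsultedS s s' (A : 'I_(nonterms G)) i j n :
    consulted W Q w s0 s -> is_substr w i j ->
    exec W Q (ask s A i j) s' n -> consulted W Q w s0 s'.

Definition serves (W q : nat) (Q : cmd) (G : cfg) (w : seq 'I_(terms G))
    (s0 : store) (F : 'I_(nonterms G) -> nat -> nat -> bool) : Prop :=
  forall s (A : 'I_(nonterms G)) i j,
    consulted W Q w s0 s -> is_substr w i j ->
    exists s' n,
      [/\ exec W Q (ask s A i j) s' n, n <= q & answer s' = F A i j].

Definition c_oracle (G : cfg) (w : seq 'I_(terms G))
    (F : 'I_(nonterms G) -> nat -> nat -> bool) : Prop :=
  forall (A : 'I_(nonterms G)) i j, is_substr w i j ->
    (c_derives w A i j -> F A i j = true) /\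
    (~ derives_sub w A i j -> F A i j = false).

Definition c_parser (P : parser) : Prop :=
  exists k q, forall (G : cfg) (w : seq 'I_(terms G)),
    exists s n F,
      let W := max_word k (parser_input_size w) n in
      [/\ exec W (prep P) (parser_input w) s n,
          c_oracle w F
        & serves W q (query P) w s F].

Definition bool_mulmx (m : nat) (A B : 'M[bool]_m) : 'M[bool]_m :=
  \matrix_(i, j) [exists k, A i k && B k j].

(* The two matrices are given in row-major order. *)
Definition matrix_code (m : nat) (A : 'M[bool]_m) : seq nat :=
  [seq nat_of_bool (A i j) | i <- enum 'I_m, j <- enum 'I_m].

Definition bmm_input (m : nat) (A B : 'M[bool]_m) : store :=
  fun a x =>
    match a with
    | 0 => nth 0 [:: m] x
    | 1 => nth 0 (matrix_code A) x
    | 2 => nth 0 (matrix_code B) x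
    | _ => 0
    end.

Definition bmm_algorithm (M : cmd) : Prop :=
  exists k, forall (m : nat) (A B : 'M[bool]_m),
    exists s n,
      exec (max_word k m n) M (bmm_input A B) s n /\
      forall i j : 'I_m, s 3 (i * m + j) = bool_mulmx A B i j.

Definition cbrt_floor (m : nat) : nat := \max_(d < m.+1 | d ^ 3 <= m) d.

Local Open Scope R_scope.

(* [exec] is deterministic, and [W] affects neither the final store nor the
   number of steps. *)
Definition parser_time_O (P : parser) (f : nat -> nat -> R) : Prop :=
  exists (C : R) (K : nat), 0 < C /\
    forall (G : cfg) (w : seq 'I_(terms G)) W s n,
      (K <= cfg_size G)%N -> (K <= size w)%N ->
      exec W (prep P) (parser_input w) s n ->
      INR n <= C * f (cfg_size G) (size w).

Definition bmm_time_O (M : cmd) (f : nat -> R) : Prop :=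
  exists (C : R) (K : nat), 0 < C /\
    forall (m : nat) (A B : 'M[bool]_m) W s n,
      (K <= m)%N ->
      exec W M (bmm_input A B) s n ->
      INR n <= C * f m.

(* Main.v *)
(* Write an index i < m as i = (p d + x) b + I with I < b and x < d, where b is
   a constant and d is about m^(1/3)/3. Fix residues I, J, K of the outer and
   inner indices. Over a string w of distinct letters, let every 1-entry of the
   first matrix in row (p, x) and column (r, z) give a production
   A_{p,r} -> w_x W w_{d+z}, every 1-entry of the second in row (r, z) and
   column (q, y) a production B_{r,q} -> w_{d+1+z} W w_{2d+1+y}, and let
   C_{p,q} -> A_{p,r} B_{r,q} for all r; W derives every string. An A-factor ends
   right before the B-factor starts exactly when the inner indices agree, so
   C_{p,q} derives w_x ... w_{2d+1+y} if and only if the product has a witness in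
   residue class K.

   As T and t are arbitrary, the grammar must have size exactly m^2 and the
   string length exactly floor(m^(1/3)); splitting by residues makes the grammar
   small enough to be padded. Each of the b^3 residue triples runs its own copy
   of the parser on renamed arrays, because the cells that the parser has written
   cannot be located and cleared for another run. *)
Require Import Defs.
From Stdlib Require Import Reals Relation_Operators FunctionalExtensionality Lra.
From mathcomp Require Import all_boot.
From mathcomp Require Import matrix zify.

Set Implicit Arguments.
Unset Strict Implicit.
Unset Printing Implicit Defensive.

(** * Execution and renaming of arrays *)

(** A c-parser may answer arbitrarily about a nonterminal that derives a substring without occurring
    in a parse of the whole string. This gap is closed by making W the start symbol and adding W ->
    C_{p,q} W: every C_{p,q} then occurs in every context, so the oracle has no freedom on the
    queries that are asked.

    The choice of d balances the two large families of productions. With P about m / (d b), there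
    are about m^2 / b^2 entry productions for each matrix and about 27 m^2 / b^3 product
    productions; both are of order m^2, and b = 32 makes the constants small enough to leave room
    for padding.

    The word bound is the other obstacle. The values computed by the driver are polynomial in m, but
    a run of the parser may use words polynomial in its own running time, on which nothing is
    assumed. Lower bounds on the total time are therefore carried along with the upper bounds. *)

Lemma word_mono W W' v x : W <= W' -> word W v = Some x -> word W' v = Some x.
Proof.
by rewrite /word; case: ifP => // vW WW' [<-]; rewrite (leq_trans vW WW').
Qed.

Lemma eval_mono W W' s e v :
  W <= W' -> eval W s e = Some v -> eval W' s e = Some v.
Proof.
move=> WW'; elim: e v => [n|a e IHe|o e1 IH1 e2 IH2] v /=.
- exact: word_mono.
- by case E: (eval W s e) => [i|] // /(word_mono WW'); rewrite (IHe _ E).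
- case E1: (eval W s e1) => [x|] //; case E2: (eval W s e2) => [y|] //.
  by move=> /(word_mono WW'); rewrite (IH1 _ E1) (IH2 _ E2).
Qed.

Lemma exec_mono W W' c s s' n : W <= W' -> exec W c s s' n -> exec W' c s s' n.
Proof.
move=> WW'; elim=> {c s s' n}; [| | | | |move=> e c s s1 s2 v n1 n2|];
  by econstructor; eauto using eval_mono.
Qed.

Lemma word_det W W' v x y : word W v = Some x -> word W' v = Some y -> x = y.
Proof. by rewrite /word; case: ifP => // _ [<-]; case: ifP => // _ [<-]. Qed.

Lemma eval_det W W' s e x y : eval W s e = Some x -> eval W' s e = Some y -> x = y.
Proof.
elim: e x y => [n|a e IHe|o e1 IH1 e2 IH2] x y /=.
- exact: word_det.
- case E: (eval W s e) => [i|] //; case E': (eval W' s e) => [i'|] //.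
  by rewrite (IHe _ _ E E'); apply: word_det.
- case E1: (eval W s e1) => [x1|] //; case E2: (eval W s e2) => [y1|] //.
  case E1': (eval W' s e1) => [x2|] //; case E2': (eval W' s e2) => [y2|] //.
  by rewrite (IH1 _ _ E1 E1') (IH2 _ _ E2 E2'); apply: word_det.
Qed.

(** The word bounds differ because running time is claimed for executions under every [W], whereas
    the execution constructed below needs a large one; determinism transfers the step count. *)
Lemma exec_det W W' c s s1 s2 n1 n2 :
  exec W c s s1 n1 -> exec W' c s s2 n2 -> s1 = s2 /\ n1 = n2.
Proof.
move=> H; elim: H s2 n2 => {c s s1 n1}.
- by move=> s s2 n2 H; inversion H.
- move=> a e1 e2 s i v Ei Ev s2 n2 H; inversion H; subst.
  match goal with
  | [ A : eval _ _ e1 = _, B : eval _ _ e2 = _ |- _ ] =>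
    by rewrite (eval_det Ei A) (eval_det Ev B)
  end.
- move=> c1 c2 s s1 s2 n1 n2 _ IH1 _ IH2 s3 n3 H; inversion H; subst.
  match goal with
  | [ A : exec _ c1 _ _ _, B : exec _ c2 _ _ _ |- _ ] =>
    by case: (IH1 _ _ A) => *; subst; case: (IH2 _ _ B) => *; subst
  end.
- move=> e c1 c2 s s' v n E v0 _ IH s2 n2 H; inversion H; subst.
    match goal with [ A : exec _ _ _ _ _ |- _ ] =>
      by case: (IH _ _ A) => *; subst end.
  match goal with [ A : eval _ _ e = Some 0 |- _ ] =>
      by rewrite (eval_det E A) eqxx in v0 end.
- move=> e c1 c2 s s' n E _ IH s2 n2 H; inversion H; subst.
    match goal with [ A : eval _ _ e = Some ?v, B : is_true (?v != 0) |- _ ] =>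
      by rewrite -(eval_det E A) eqxx in B end.
  match goal with [ A : exec _ _ _ _ _ |- _ ] =>
      by case: (IH _ _ A) => *; subst end.
- move=> e c s s1 s2 v n1 n2 E v0 _ IH1 _ IH2 s3 n3 H; inversion H; subst.
    match goal with
    | [ A : exec _ c _ _ _, B : exec _ (While e c) _ _ _ |- _ ] =>
      by case: (IH1 _ _ A) => *; subst; case: (IH2 _ _ B) => *; subst
    end.
  match goal with [ A : eval _ _ e = Some 0 |- _ ] =>
      by rewrite (eval_det E A) eqxx in v0 end.
- move=> e c s E s2 n2 H; inversion H; subst => //.
  match goal with [ A : eval _ _ e = Some ?v, B : is_true (?v != 0) |- _ ] =>
      by rewrite -(eval_det E A) eqxx in B end.
Qed.

Lemma exec_gt0 W c s s' n : exec W c s s' n -> 0 < n.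
Proof. by elim=> // *; rewrite addn_gt0; apply/orP; left. Qed.

Section Renaming.
Variable h : nat -> nat.

Fixpoint rename_expr (e : expr) : expr :=
  match e with
  | Lit n => Lit n
  | Get a e1 => Get (h a) (rename_expr e1)
  | Bin o e1 e2 => Bin o (rename_expr e1) (rename_expr e2)
  end.

Fixpoint rename (c : cmd) : cmd :=
  match c with
  | Skip => Skip
  | Put a e1 e2 => Put (h a) (rename_expr e1) (rename_expr e2)
  | Seq c1 c2 => Seq (rename c1) (rename c2)
  | If e c1 c2 => If (rename_expr e) (rename c1) (rename c2)
  | While e c1 => While (rename_expr e) (rename c1)
  end.

Lemma ecost_rename e : ecost (rename_expr e) = ecost e.
Proof. by elim: e => //= [a e ->|o e1 -> e2 ->]. Qed.

Lemma eval_rename W S e :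
  eval W S (rename_expr e) = eval W (fun a => S (h a)) e.
Proof. by elim: e => //= [a e ->|o e1 -> e2 ->]. Qed.

Hypothesis h_inj : injective h.

(** Injectivity keeps a write to one array from showing up in another. The frame clause, that arrays
    outside the range of [h] are untouched, is what lets several copies of the parser and the driver
    share one store. *)
Lemma exec_rename W c s s' n S :
  exec W c s s' n -> (fun a => S (h a)) = s ->
  exists S', [/\ exec W (rename c) S S' n, (fun a => S' (h a)) = s'
    & forall b, (forall a, b <> h a) -> S' b = S b].
Proof.
move=> H; elim: H S => {c s s' n}.
- by move=> s S <-; exists S; split=> //; apply: ExecSkip.
- move=> a e1 e2 s i v Ei Ev S ES; exists (upd S (h a) i v); split.
  + by rewrite -(ecost_rename e1) -(ecost_rename e2); apply: ExecPut;
      rewrite eval_rename ES.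
  + apply: functional_extensionality => b; apply: functional_extensionality => j.
    by rewrite /upd (inj_eq h_inj) -ES.
  + move=> b Hb; apply: functional_extensionality => j; rewrite /upd.
    by case: eqP => // /Hb.
- move=> c1 c2 s s1 s2 n1 n2 _ IH1 _ IH2 S /IH1[S1 [X1 E1 F1]].
  case/IH2: E1 => S2 [X2 E2 F2]; exists S2; split=> //=.
    exact: ExecSeq X1 X2.
  by move=> b Hb; rewrite F2 ?F1.
- move=> e c1 c2 s s' v n E v0 _ IH S ES; case/IH: (ES) => S' [X' E' F'].
  exists S'; split=> //=; rewrite -(ecost_rename e).
  by apply: ExecIfTrue v0 X'; rewrite eval_rename ES.
- move=> e c1 c2 s s' n E _ IH S ES; case/IH: (ES) => S' [X' E' F'].
  exists S'; split=> //=; rewrite -(ecost_rename e).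
  by apply: ExecIfFalse X'; rewrite eval_rename ES.
- move=> e c s s1 s2 v n1 n2 E v0 _ IH1 _ IH2 S ES.
  case/IH1: (ES) => S1 [X1 E1 F1]; case/IH2: E1 => S2 [X2 E2 F2].
  exists S2; split=> //=; last by move=> b Hb; rewrite F2 ?F1.
  rewrite -(ecost_rename e); apply: ExecWhileTrue v0 X1 X2.
  by rewrite eval_rename ES.
- move=> e c s E S ES; exists S; split=> //=; rewrite -(ecost_rename e).
  by apply: ExecWhileFalse; rewrite eval_rename ES.
Qed.

End Renaming.

(** The invariant is indexed by the number of completed rounds, which gives termination together
    with the final state. The factor [cnt.+1] pays for the last, failing test. *)
Lemma exec_for W (I : nat -> store -> Prop) cond body cnt T :
    (forall i s, i < cnt -> I i s -> eval W s cond = Some 1) ->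
    (forall s, I cnt s -> eval W s cond = Some 0) ->
    (forall i s, i < cnt -> I i s ->
       exists s' n, [/\ exec W body s s' n, n <= T & I i.+1 s']) ->
  forall s, I 0 s -> exists s' n,
    [/\ exec W (While cond body) s s' n, n <= (T + ecost cond).+1 * cnt.+1
      & I cnt s'].
Proof.
move=> Ht Hf Hb s Is.
suff H k i s0 : i + k = cnt -> I i s0 -> exists s' n,
    [/\ exec W (While cond body) s0 s' n, n <= (T + ecost cond).+1 * k.+1
      & I cnt s'] by exact: (H cnt 0).
elim: k i s0 => [|k IHk] i s0 Ek Ii.
  move: Ii; rewrite addn0 in Ek; rewrite Ek => Ii.
  exists s0, (ecost cond).+1; split=> //; last by lia.
  exact: ExecWhileFalse (Hf _ Ii).
have lti : i < cnt by rewrite -Ek; lia.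
case: (Hb _ _ lti Ii) => s1 [n1 [X1 L1 I1]].
case: (IHk i.+1 s1 _ I1) => [|s2 [n2 [X2 L2 I2]]]; first by lia.
exists s2, (n1 + n2 + ecost cond).+1; split=> //; last by nia.
exact: ExecWhileTrue (Ht _ _ lti Ii) _ X1 X2.
Qed.

(** * Derivations *)

Section DerivationTheory.
Variable G : cfg.

Lemma derives_trans (a b c : seq (symbol G)) :
  @derives G a b -> @derives G b c -> @derives G a c.
Proof. exact: rt_trans. Qed.

Lemma derives_ctx (u v a b : seq (symbol G)) :
  @derives G a b -> @derives G (u ++ a ++ v) (u ++ b ++ v).
Proof.
elim=> {a b} [a b [u' v' p pG]|a|a b c _ IH1 _ IH2].
- have E x : u ++ (u' ++ x ++ v') ++ v = (u ++ u') ++ x ++ (v' ++ v).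
    by rewrite !catA.
  by rewrite -(cat1s _ v') !E; apply: rt_step; apply: Rewrites.
- exact: rt_refl.
- exact: derives_trans IH1 IH2.
Qed.

Lemma derives_prod (A : 'I_(nonterms G)) rhs :
  (A, rhs) \in prods G -> @derives G [:: inl A] rhs.
Proof.
move=> pG; apply: rt_step.
by have := @Rewrites G [::] [::] _ pG; rewrite /= cats0.
Qed.

Variable Lang : nat -> seq nat -> Prop.

(** The semantics of sentential forms when nonterminals denote [Lang]. Letters are plain numbers so
    that [Lang] can be given without the ordinal types of [G]. *)
Fixpoint Lform (alpha : seq (symbol G)) (u : seq nat) : Prop :=
  match alpha with
  | [::] => u = [::]
  | inl A :: alpha' => exists u1 u2, [/\ u = u1 ++ u2, Lang A u1 & Lform alpha' u2]
  | inr a :: alpha' => exists2 u', u = val a :: u' & Lform alpha' u'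
  end.

Lemma Lform_cat alpha beta u :
  Lform (alpha ++ beta) u <->
  exists u1 u2, [/\ u = u1 ++ u2, Lform alpha u1 & Lform beta u2].
Proof.
split.
  elim: alpha u => [|[A|a] alpha IH] u /=.
  - by move=> H; exists [::], u.
  - case=> u1 [u2 [-> LA /IH[u3 [u4 [-> L3 L4]]]]].
    by exists (u1 ++ u3), u4; rewrite catA; split=> //; exists u1, u3.
  - case=> u' -> /IH[u3 [u4 [-> L3 L4]]].
    by exists (val a :: u3), u4; split=> //; exists u3.
elim: alpha u => [|[A|a] alpha IH] u /=.
- by case=> u1 [u2 [-> -> ]].
- case=> u1 [u2 [-> [u3 [u4 [-> LA L3]]] L4]].
  by exists u3, (u4 ++ u2); rewrite catA; split=> //; apply/IH; exists u4, u2.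
- case=> u1 [u2 [-> [u3 -> L3] L4]].
  by exists (u3 ++ u2) => //; apply/IH; exists u3, u2.
Qed.

Lemma Lform_tm (w : seq 'I_(terms G)) : Lform (tm w) (map val w).
Proof. by elim: w => //= a w IHw; exists (map val w). Qed.

(** Generated languages are the least solution of the productions, hence lie below every family
    closed under them. A derivation is read backwards: membership is pulled back through each
    rewriting step. *)
Lemma derives_sound :
    (forall A rhs u, (A, rhs) \in prods G -> Lform rhs u -> Lang (val A) u) ->
  forall A w, @derives G [:: inl A] (tm w) -> Lang (val A) (map val w).
Proof.
move=> closed A w /=.
suff H a b : @derives G a b -> forall u, Lform b u -> Lform a u.
  move/H=> /(_ _ (Lform_tm w)) /= [u1 [u2 [-> LA ->]]].
  by rewrite cats0.
elim=> {a b} [a b [u v [B rhs] pG]|a|a b c _ IH1 _ IH2] // x.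
  case/Lform_cat=> u1 [u2 [-> L1 /Lform_cat[u3 [u4 [-> L3 L4]]]]].
  apply/Lform_cat; exists u1, (u3 ++ u4); split=> //=.
  by exists u3, u4; split=> //; apply: closed pG _.
by move/IH2/IH1.
Qed.

End DerivationTheory.

(* Grammars are built from productions over natural numbers, numbered as in
   [symbol_code]. *)
Section NumericGrammar.
Variables nt' N' : nat.
Notation nt := nt'.+1.
Notation N := N'.+1.

Definition sym_of (s : nat) : 'I_nt + 'I_N :=
  if s < nt then inl (inord s) else inr (inord (s - nt)).

Definition prod_of (p : nat * seq nat) : 'I_nt * seq ('I_nt + 'I_N) :=
  (inord p.1, map sym_of p.2).

Definition in_range (p : nat * seq nat) :=
  (p.1 < nt) && all (fun s => s < nt + N) p.2.

Definition num_of (x : 'I_nt + 'I_N) : nat :=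
  match x with inl A => A | inr a => nt + a end.

Lemma sym_ofK s : s < nt + N -> num_of (sym_of s) = s.
Proof. by rewrite /sym_of => ltsN; case: ifP => H /=; rewrite inordK; lia. Qed.

Lemma sym_of_nt s : s < nt -> sym_of s = inl (inord s).
Proof. by rewrite /sym_of => ->. Qed.

Lemma sym_of_tm l : sym_of (nt + l) = inr (inord l).
Proof. by rewrite /sym_of ltnNge leq_addr /= addKn. Qed.

(** Out of range [inord] collapses numbers; within range the numbering is lossless, which carries
    uniqueness and the machine encoding over to the typed grammar. *)
Lemma prod_ofK p : in_range p ->
  (val (prod_of p).1, map num_of (prod_of p).2) = p.
Proof.
case: p => A rhs /andP[/= ltA /allP ok]; rewrite inordK //; congr pair.
rewrite -map_comp -[RHS]map_id; apply/eq_in_map => s /ok; exact: sym_ofK.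
Qed.

Lemma uniq_prods_of ps : uniq ps -> all in_range ps -> uniq (map prod_of ps).
Proof.
move=> U /allP ok; rewrite map_inj_in_uniq // => p q /ok okp /ok okq E.
by rewrite -(prod_ofK okp) -(prod_ofK okq) E.
Qed.

Variables (ps : seq (nat * seq nat)) (U : uniq ps) (ok : all in_range ps).

Definition num_cfg : cfg :=
  @Cfg nt N (map prod_of ps) ord0 (uniq_prods_of U ok).

Lemma cfg_code_num : cfg_code num_cfg =
  [:: nt; N; 0; size ps] ++ flatten [seq p.1 :: size p.2 :: p.2 | p <- ps].
Proof.
rewrite /cfg_code /= size_map; congr [:: _, _, _, _ & _]; congr flatten.
rewrite -map_comp; apply/eq_in_map => p /(allP ok) okp.
rewrite -[RHS](congr1 (fun q => q.1 :: size q.2 :: q.2) (prod_ofK okp)) /=.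
rewrite !size_map; congr [:: _, _ & _]; rewrite -!map_comp.
Qed.

Lemma cfg_size_num : cfg_size num_cfg = sumn [seq (size p.2).+1 | p <- ps].
Proof.
rewrite /cfg_size /= -map_comp; congr sumn.
by apply: eq_map => p /=; rewrite size_map.
Qed.

Lemma mem_prods_num A rhs : (A, rhs) \in ps ->
  (inord A, map sym_of rhs) \in prods num_cfg.
Proof. by move=> H; apply: (map_f prod_of) H. Qed.

End NumericGrammar.

(** * The grammar of a pair of matrices *)

Lemma pair_lt i j n k : i < n -> j < k -> i * k + j < n * k.
Proof. by move=> lti ltj; nia. Qed.

(** Tags that increase along a concatenation reduce uniqueness to the single blocks, without
    comparing blocks pairwise. *)
Lemma uniq_cat_tag (T : eqType) (g : T -> nat) i (s1 s2 : seq T) :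
  all (fun x => g x == i) s1 -> all (fun x => i < g x) s2 ->
  uniq s1 -> uniq s2 -> uniq (s1 ++ s2).
Proof.
move=> /allP t1 /allP t2 u1 u2; rewrite cat_uniq u1 u2 andbT /=.
apply/hasPn=> x /t2 gx; apply/negP=> /t1 /eqP E.
by rewrite E ltnn in gx.
Qed.

Section ReductionGrammar.
(** [N] is the string length, [d] the segment length, [P] the number of blocks, [L] the padding;
    [f false] and [f true] are the residue submatrices of the first and second factor. *)
Variables (N d P L : nat) (f : bool -> nat -> nat -> bool).
Notation PP := (P * P).

(** For each pair of blocks there is one product nonterminal and four entry nonterminals: two
    matrices times two values of the flag [c]. *)
Definition num_nonterms := 2 + 5 * PP.
Notation nt := num_nonterms.

(* Nonterminal 0 is W, 1 heads the padding production, [2 + (p * P + q)] is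
   C_{p,q}, and [vcode t k c] with [k = p * P + r] is A_{p,r} ([t = false]) or
   B_{p,r} ([t = true]). Entries equal to 0 get a production as well, headed by
   the useless nonterminal with [c = false]: the layout of the grammar does not
   depend on the matrices. *)
Definition vcode (t : bool) (k : nat) (c : bool) : nat :=
  2 + PP + ((t * PP + k) * 2 + c).

Definition filler_prod l := (0, [:: nt + l; 0]).
(** Places each C_{p,q} between arbitrary strings, so that for these nonterminals derivation and
    c-derivation coincide. *)
Definition insert_prod k := (0, [:: 2 + k; 0]).

(** The rank is [k = r * PP + (p * P + q)], with [r] the inner block. *)
Definition product_prod k :=
  (2 + k %% PP, [:: vcode false (k %% PP %/ P * P + k %/ PP) true;
                    vcode true (k %/ PP * P + k %% PP %% P) true]).

(** The rank is [e = (k * d + x) * d + z]: a pair [k] of blocks, a row offset [x] and a column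
    offset [z]. *)
Definition entry t e :=
  let k := e %/ d %/ d in
  f t (k %/ P * d + e %/ d %% d) (k %% P * d + e %% d).

Definition entry_prod t e :=
  (vcode t (e %/ d %/ d) (entry t e),
   [:: nt + (e %/ d %% d + t * (d + 1)); 0; nt + (d + e %% d + t * (d + 1))]).

(** The length of the last production is adjustable: it brings the grammar to the prescribed size
    and leaves the languages of all other nonterminals unchanged. *)
Definition red_prods : seq (nat * seq nat) :=
  (0, [::]) ::
  map filler_prod (iota 0 N) ++
  map insert_prod (iota 0 PP) ++
  map product_prod (iota 0 (PP * P)) ++
  map (entry_prod false) (iota 0 (PP * (d * d))) ++
  map (entry_prod true) (iota 0 (PP * (d * d))) ++
  [:: (1, nseq L nt)].

Lemma size_red_prods : size red_prods = 2 + N + PP + PP * P + 2 * (PP * (d * d)).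
Proof. by rewrite /= !size_cat !size_map !size_iota /=; lia. Qed.

Lemma sumn_red_prods : sumn [seq (size p.2).+1 | p <- red_prods] =
  2 + 3 * N + 3 * PP + 3 * (PP * P) + 8 * (PP * (d * d)) + L.
Proof.
rewrite /= !map_cat !sumn_cat /= -!map_comp size_nseq.
have E c (g : nat -> nat) n : (forall i, g i = c) -> sumn (map g (iota 0 n)) = c * n.
  move=> /eq_map-> ; elim: n 0 => [|n IH] m /=; first by rewrite muln0.
  by rewrite IH mulnS.
rewrite (E 3) // (E 3) // (E 3) // !(E 4) //. lia.
Qed.

Lemma vcode_lt t k c : k < PP -> vcode t k c < nt.
Proof. by rewrite /vcode /num_nonterms; case: t; case: c => /=; lia. Qed.

Lemma vcode_inj t t' k k' c c' : k < PP -> k' < PP ->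
  vcode t k c = vcode t' k' c' -> [/\ t = t', k = k' & c = c'].
Proof.
rewrite /vcode; case: t; case: t'; case: c; case: c' => /= ltk ltk' E; split=> //; lia.
Qed.

Definition entry_lang (t : bool) k (u : seq nat) := exists x z v,
  [/\ x < d, z < d, f t (k %/ P * d + x) (k %% P * d + z) &
     u = (x + t * (d + 1)) :: v ++ [:: d + z + t * (d + 1)]].

(* An over-approximation of the strings derived by the nonterminal [s], exact
   for the product nonterminals. *)
Definition red_lang (s : nat) (u : seq nat) : Prop :=
  if s < 2 then True
  else if s < 2 + PP then
    exists r u1 u2, [/\ r < P, u = u1 ++ u2,
      entry_lang false ((s - 2) %/ P * P + r) u1 &
      entry_lang true (r * P + (s - 2) %% P) u2]
  else let v := s - (2 + PP) in odd v -> entry_lang (PP <= v./2) (v./2 %% PP) u.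

Lemma red_lang_vcode t k c u : k < PP ->
  red_lang (vcode t k c) u <-> (c -> entry_lang t k u).
Proof.
move=> ltk; rewrite /red_lang /vcode -addnA ltnNge leq_addr /= addnA.
rewrite ltnNge leq_addr /= addKn oddD oddM andbF oddb /=.
have -> : ((t * PP + k) * 2 + c)./2 = t * PP + k.
  by rewrite addnC muln2 half_bit_double.
rewrite modnMDl modn_small //.
by have -> : (PP <= t * PP + k) = t by case: t; lia.
Qed.

Hypotheses (dP : 0 < d) (PP0 : 0 < P).

Lemma entry_rank e : e < PP * (d * d) -> e %/ d %/ d < PP.
Proof. by move=> lte; rewrite !ltn_divLR // -mulnA. Qed.

Lemma rank_row k : k < PP -> k %/ P < P.
Proof. by move=> ltk; rewrite ltn_divLR. Qed.

Lemma product_rank k : k < PP * P ->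
  [/\ k %/ PP < P, k %% PP < PP, k %% PP %/ P < P & k %% PP %% P < P].
Proof.
move=> ltk; have PP1 : 0 < PP by rewrite muln_gt0 PP0.
have H : k %% PP < PP by rewrite ltn_mod.
by rewrite H rank_row // ltn_mod PP0 ltn_divLR // mulnC.
Qed.

Lemma red_lang_product p q u : p < P -> q < P ->
  red_lang (2 + (p * P + q)) u <-> exists r u1 u2,
    [/\ r < P, u = u1 ++ u2, entry_lang false (p * P + r) u1 &
      entry_lang true (r * P + q) u2].
Proof.
move=> ltp ltq; rewrite /red_lang /= ltn_add2l pair_lt // addKn.
by rewrite divnMDl // modnMDl divn_small // modn_small // addn0.
Qed.

Definition hit p q x y := exists u,
  [/\ u < P * d, f false (p * d + x) u & f true u (q * d + y)].

(** The string is an interval of distinct letters, so each position determines its letter. Comparing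
    letters at the ends of both factors fixes the outer offsets and forces the two inner ones to
    agree. *)
Lemma product_lang_hit p q x y : p < P -> q < P -> x < d -> y < d ->
  red_lang (2 + (p * P + q)) (iota x (d + d + 2 + y - x)) -> hit p q x y.
Proof.
move=> ltp ltq ltx lty /red_lang_product[] // r [u1 [u2 [ltr Eu]]].
case=> x1 [z1 [v1 [ltx1 ltz1 f1 E1]]] [x2 [z2 [v2 [ltx2 ltz2 f2 E2]]]].
move: f1 f2; rewrite !divnMDl // !modnMDl !divn_small // !modn_small // !addn0.
move=> f1 f2.
have Es := congr1 size Eu.
move: Es; rewrite size_iota size_cat E1 E2 /= !size_cat /= => Es.
have nthE i : i < d + d + 2 + y - x -> nth 0 (u1 ++ u2) i = x + i.
  by move=> lti; rewrite -Eu nth_iota.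
rewrite E1 E2 /= -catA /= in nthE.
(* The four positions are the first and last letters of both factors. The middle two are adjacent,
   whence [d + z1 + 1 = x2 + (d + 1)], that is [z1 = x2]. *)
have H0 : x1 + 0 * (d + 1) = x + 0 by apply: (nthE 0); lia.
have H1 : d + z1 + 0 * (d + 1) = x + (size v1).+1.
  by rewrite -nthE /= ?nth_cat ?ltnn ?subnn //; lia.
have H2 : x2 + 1 * (d + 1) = x + (size v1).+2.
  by rewrite -nthE /= ?nth_cat ?ltnNge ?leqnSn ?subSnn //; lia.
have H3 : d + z2 + 1 * (d + 1) = x + (size v1 + size v2).+3.
  rewrite -nthE /= ?nth_cat; last by lia.
  have -> : (size v1 + size v2).+2 - size v1 = (size v2).+2 by lia.
  by rewrite ifF /= ?nth_cat; [rewrite ltnn subnn|lia].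
exists (r * d + z1); split.
- exact: pair_lt.
- by have <- : x1 = x by lia.
- by have -> : z1 = x2 by [lia]; have <- : z2 = y by lia.
Qed.

Hypothesis dN : 3 * d < N.

(** Numbers the blocks of [red_prods] in list order. The three kinds of productions of W are told
    apart by the first symbol of the body. *)
Definition prod_tag (p : nat * seq nat) : nat :=
  if p.1 == 0 then if p.2 is s :: _ then (if s < nt then 2 else 1) else 0
  else if p.1 == 1 then 6
  else if p.1 < 2 + PP then 3 else if p.1 < 2 + PP + 2 * PP then 4 else 5.

Lemma red_prods_in_range : all (fun p => (p.1 < nt) && all (fun s => s < nt + N) p.2) red_prods.
Proof.
(* The largest letter is [2 * d - 1 + (d + 1) = 3 * d], which is why the string must be longer than
   [3 * d]. *)
have T (t : bool) x : x < 2 * d -> nt + (x + t * (d + 1)) < nt + N.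
  by case: t => /=; lia.
have V t k c : k < PP -> vcode t k c < nt + N.
  by move/(vcode_lt t c); lia.
have E t : all (fun p => (p.1 < nt) && all (fun s => s < nt + N) p.2)
    (map (entry_prod t) (iota 0 (PP * (d * d)))).
  apply/allP=> _ /mapP[e + ->]; rewrite mem_iota => /andP[_ /entry_rank ltk] /=.
  have [x1 x2] : e %/ d %% d < d /\ e %% d < d by rewrite !ltn_mod.
  rewrite vcode_lt // !T ?andbT; [|lia..].
  by rewrite /num_nonterms; lia.
rewrite /= !all_cat /= (all_map filler_prod) (all_map insert_prod) (all_map product_prod).
apply/and5P; split; [| | |
  |apply/andP; split].
- by apply/allP=> l; rewrite mem_iota /= /num_nonterms => ltl; rewrite /=; lia.
- by apply/allP=> l; rewrite mem_iota /= /num_nonterms => ltl; rewrite /=; lia.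
- apply/allP=> k; rewrite mem_iota => /andP[_ /product_rank[r1 r2 r3 r4]] /=.
  rewrite !V ?pair_lt // !andbT; rewrite /num_nonterms; lia.
- exact: E.
- exact: E.
- rewrite /= andbT; by apply/allP=> s /nseqP[-> _]; lia.
Qed.

(** Within a block the rank can be read off the production. For products the head gives the outer
    blocks and the first symbol the inner one. *)
Lemma red_prods_uniq : uniq red_prods.
Proof.
have t1 : all (fun x => prod_tag x == 1) (map filler_prod (iota 0 N)).
  by rewrite all_map; apply/allP=> l _ /=; rewrite /prod_tag /= ltnNge leq_addr.
have t2 : all (fun x => prod_tag x == 2) (map insert_prod (iota 0 PP)).
  rewrite all_map; apply/allP=> l; rewrite mem_iota => ltl /=.
  by rewrite /prod_tag /= /num_nonterms; case: ifP => //; lia.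
have t3 : all (fun x => prod_tag x == 3) (map product_prod (iota 0 (PP * P))).
  rewrite all_map; apply/allP=> k; rewrite mem_iota => /andP[_ /product_rank[_ H _ _]] /=.
  by rewrite /prod_tag /= ifT //; lia.
have t45 (t : bool) : all (fun x => prod_tag x == 4 + t)
    (map (entry_prod t) (iota 0 (PP * (d * d)))).
  rewrite all_map; apply/allP=> e; rewrite mem_iota => /andP[_ /entry_rank ltk] /=.
  rewrite /prod_tag /= /vcode /= ltnNge leq_addr /= ltn_add2l.
  move: (e %/ d %/ d) (entry t e) ltk => k c; move: (P * P) => Q ltk.
  by case: t; rewrite ?mul1n ?mul0n; case: c; case: ifP => H //; lia.
have t6 : all (fun x => prod_tag x == 6) [:: (1, nseq L nt)] by [].
have up i j s : j < i -> all (fun x => prod_tag x == i) s -> all (fun x => j < prod_tag x) s.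
  by move=> ltji /allP H; apply/allP => x /H /eqP->.
rewrite /red_prods -cat1s.
have N0 : 0 < N by lia.
apply: (@uniq_cat_tag _ prod_tag 0) => //.
  by rewrite !all_cat (up _ _ _ _ t1) // (up _ _ _ _ t2) // (up _ _ _ _ t3) // (up _ _ _ _ (t45 false)) // (up _ _ _ _ (t45 true)).
apply: (@uniq_cat_tag _ prod_tag 1) => //.
    by rewrite !all_cat (up _ _ _ _ t2) // (up _ _ _ _ t3) // (up _ _ _ _ (t45 false)) // (up _ _ _ _ (t45 true)).
  by rewrite map_inj_uniq ?iota_uniq // => x y [] /eqP; rewrite eqn_add2l => /eqP.
apply: (@uniq_cat_tag _ prod_tag 2) => //.
    by rewrite !all_cat (up _ _ _ _ t3) // (up _ _ _ _ (t45 false)) // (up _ _ _ _ (t45 true)).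
  by rewrite map_inj_uniq ?iota_uniq // => x y [].
(* Whatever the entry is, the head determines [k], and the two letters determine the offsets. *)
have entry_uniq t : uniq (map (entry_prod t) (iota 0 (PP * (d * d)))).
  rewrite map_inj_in_uniq ?iota_uniq // => e e'.
  rewrite !mem_iota => /andP[_ /entry_rank lte] /andP[_ /entry_rank lte'] E.
  have [_ Ek _] := vcode_inj lte lte' (congr1 fst E).
  case: E => _ Ex Ez.
  rewrite (divn_eq e d) (divn_eq e' d) (divn_eq (e %/ d) d) (divn_eq (e' %/ d) d) Ek.
  by congr ((_ + _) * _ + _); lia.
apply: (@uniq_cat_tag _ prod_tag 3) => //.
    by rewrite !all_cat (up _ _ _ _ (t45 false)) // (up _ _ _ _ (t45 true)).
  rewrite map_inj_in_uniq ?iota_uniq // => k k'.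
  rewrite !mem_iota => /andP[_ /product_rank[r1 r2 r3 r4]].
  move=> /andP[_ /product_rank[s1 s2 s3 s4]] E.
  have /eqP := congr1 fst E; have Ev := congr1 (fun p => head 0 p.2) E.
  rewrite eqn_add2l => /eqP Em.
  have [_ Ek _] := vcode_inj (pair_lt r3 r1) (pair_lt s3 s1) Ev.
  rewrite (divn_eq k PP) (divn_eq k' PP) Em; congr (_ * _ + _).
  by move: Ek; rewrite Em => /eqP; rewrite eqn_add2l => /eqP.
apply: (@uniq_cat_tag _ prod_tag 4) => //.
- exact: t45 false.
- by rewrite !all_cat (up _ _ _ _ (t45 true)).
apply: (@uniq_cat_tag _ prod_tag 5) => //.
exact: t45 true.
Qed.

End ReductionGrammar.

Lemma val_inord_iota N' i n : i + n <= N'.+1 ->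
  map val (map inord (iota i n) : seq 'I_N'.+1) = iota i n.
Proof.
move=> le; rewrite -map_comp -[RHS]map_id; apply/eq_in_map=> k.
by rewrite mem_iota => /andP[_ ltk] /=; rewrite inordK //; lia.
Qed.

(** The cut belonging to the inner offset [z] comes right after the letter [d + z]; the next letter
    [z + (d + 1)] opens the second factor. *)
Lemma iota_entries d x y z : x < d -> y < d -> z < d ->
  iota x (d + d + 2 + y - x) =
  (x :: iota x.+1 (d + z - x.+1) ++ [:: d + z]) ++
  z + (d + 1) :: iota (z + d).+2 (d + y - z.+1) ++ [:: d + y + (d + 1)].
Proof.
move=> ltx lty ltz.
have -> : d + d + 2 + y - x = (d + z - x.+1 + 1).+1 + (d + y - z.+1 + 1).+1 by lia.
rewrite iotaD /= !iotaD /=.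
have -> : x.+1 + (d + z - x.+1) = d + z by lia.
have -> : x + (d + z - x.+1 + 1).+1 = z + (d + 1) by lia.
have -> : (z + (d + 1)).+1 = (z + d).+2 by lia.
by have -> : (z + d).+2 + (d + y - z.+1) = d + y + (d + 1) by lia.
Qed.

(** * Correctness of the reduction grammar *)

Section ReductionCfg.
Variables (N' d P L : nat) (f : bool -> nat -> nat -> bool).
Notation N := N'.+1.
Notation PP := (P * P).
Notation nt' := (1 + 5 * PP).
Hypotheses (d0 : 0 < d) (P0 : 0 < P) (dN : 3 * d < N).

Definition red_cfg : cfg :=
  @num_cfg nt' N' _ (red_prods_uniq L f d0 P0 dN) (red_prods_in_range L f d0 P0 dN).

Definition red_string : seq 'I_N := map inord (iota 0 N).

Notation sym := (@sym_of nt' N').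

Notation A0 := (inord 0 : 'I_nt'.+1).

Lemma sym0 : sym 0 = inl A0.
Proof. exact: sym_of_nt. Qed.

Lemma symT l : sym (num_nonterms P + l) = inr (inord l).
Proof. exact: sym_of_tm. Qed.

Lemma entry_pos (t : bool) x : x < 2 * d -> x + t * (d + 1) < N.
Proof. by case: t => /=; lia. Qed.

(** Productions of W and of the padding nonterminal are harmless, as their heads are assigned all
    strings. The entry and product productions match the clauses of [red_lang]. *)
Lemma red_closed A rhs u : (A, rhs) \in prods red_cfg ->
  @Lform red_cfg (red_lang d P f) rhs u -> red_lang d P f (val A) u.
Proof.
case/mapP=> p pin [-> ->].
have /andP[ltp _] := allP (red_prods_in_range L f d0 P0 dN) _ pin.
have E t e : e \in iota 0 (PP * (d * d)) ->
    @Lform red_cfg (red_lang d P f) (map sym (entry_prod d P f t e).2) u ->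
    red_lang d P f (entry_prod d P f t e).1 u.
  rewrite mem_iota => /andP[_ /(entry_rank d0) ltk].
  have [x1 x2] : e %/ d %% d < d /\ e %% d < d by rewrite !ltn_mod.
  rewrite /entry_prod; cbn [map fst snd]; rewrite sym0 !symT /=.
  case=> u1 -> [u2 [u3 [-> _ [u4 -> ->]]]].
  rewrite !inordK ?entry_pos //; try lia.
  apply/red_lang_vcode => // fe.
  by exists (e %/ d %% d), (e %% d), u2.
rewrite /= inordK //; move: pin {ltp}; rewrite inE !mem_cat.
case/or4P=> [/eqP->|/mapP[k _ ->]|/mapP[k _ ->]|] //.
case/or4P=> [/mapP[k + ->]|/mapP[e + ->]|/mapP[e + ->]|].
- rewrite mem_iota => /andP[_ /(product_rank P0)[r1 r2 r3 r4]].
  have [k1 k2] := (pair_lt r3 r1, pair_lt r1 r4).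
  rewrite /= !sym_of_nt ?vcode_lt //= !inordK ?vcode_lt //.
  case=> u1 [u2 [-> /(red_lang_vcode _ _ _ _ _ k1) H1 [u3 [u4 [-> ]]]]].
  move=> /(red_lang_vcode _ _ _ _ _ k2) H2 ->.
  rewrite [X in 2 + X](divn_eq _ P) red_lang_product //.
  by exists (k %/ PP), u1, u3; rewrite cats0; split; auto.
- exact: E.
- exact: E.
- by rewrite inE => /eqP->.
Qed.

Notation tmR := (@tm red_cfg).

Lemma red_step A rhs : (A, rhs) \in red_prods N d P L f ->
  @derives red_cfg [:: inl (inord A)] (map sym rhs).
Proof. by move=> H; apply: derives_prod; apply: mem_prods_num. Qed.

Lemma filler_step (l : 'I_N) (b : seq (symbol red_cfg)) :
  @derives red_cfg [:: inl A0] b -> @derives red_cfg [:: inl A0] (inr l :: b).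
Proof.
move=> H; have X := @derives_ctx red_cfg [:: inr l] [::] _ _ H.
rewrite /= cats0 in X; apply: derives_trans _ X.
have := @red_step 0 [:: num_nonterms P + l; 0] _.
cbn [map]; rewrite sym0 symT inord_val; apply.
rewrite inE mem_cat; apply/orP; right; apply/orP; left.
by apply/mapP; exists (val l); rewrite ?mem_iota //= add0n.
Qed.

Lemma filler_derives (u : seq 'I_N) : @derives red_cfg [:: inl A0] (tmR u).
Proof.
elim: u => [|l u IHu]; last exact: filler_step.
by apply: (@red_step 0 [::]); rewrite inE.
Qed.

Lemma context_derives k (u v : seq 'I_N) : k < PP ->
  @derives red_cfg [:: inl A0] (tmR u ++ inl (inord (2 + k)) :: tmR v).
Proof.
move=> ltk; elim: u => [|l u IHu]; last exact: filler_step.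
have X := @derives_ctx red_cfg [:: inl (inord (2 + k))] [::] _ _ (filler_derives v).
rewrite /= cats0 in X; apply: derives_trans _ X.
have := @red_step 0 [:: 2 + k; 0] _; cbn [map].
rewrite sym0 sym_of_nt; last by lia.
apply; rewrite inE !mem_cat; apply/orP; right; apply/orP; right; apply/orP; left.
by apply: map_f; rewrite mem_iota.
Qed.

Lemma entry_derives t k x z (v : seq 'I_N) : k < PP -> x < d -> z < d ->
  f t (k %/ P * d + x) (k %% P * d + z) ->
  @derives red_cfg [:: inl (inord (vcode P t k true))]
    (tmR (inord (x + t * (d + 1)) :: v ++ [:: inord (d + z + t * (d + 1))])).
Proof.
move=> ltk ltx ltz fxz; set e := (k * d + x) * d + z.
have Ez : e %% d = z by rewrite modnMDl modn_small.
have Eq : e %/ d = k * d + x by rewrite divnMDl // divn_small // addn0.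
have Ex : e %/ d %% d = x by rewrite Eq modnMDl modn_small.
have Ek : e %/ d %/ d = k by rewrite Eq divnMDl // divn_small // addn0.
have lte : e < PP * (d * d) by rewrite mulnA; do !apply: pair_lt.
have pin : entry_prod d P f t e \in red_prods N d P L f.
  rewrite inE !mem_cat; apply/orP; right; do 3 (apply/orP; right).
  case: t fxz => _; last by apply/orP; left; apply: map_f; rewrite mem_iota.
  by apply/orP; right; apply/orP; left; apply: map_f; rewrite mem_iota.
have := red_step pin; cbn [map]; rewrite sym0 !symT /entry Ek Ex Ez fxz => H.
apply: derives_trans H _.
have := @derives_ctx red_cfg [:: inr (inord (x + t * (d + 1)))]
  [:: inr (inord (d + z + t * (d + 1)))] _ _ (filler_derives v).
by rewrite /tm /= map_cat.
Qed.

Lemma product_derives p q r x y z (v1 v2 : seq 'I_N) :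
    p < P -> q < P -> r < P -> x < d -> y < d -> z < d ->
    f false (p * d + x) (r * d + z) -> f true (r * d + z) (q * d + y) ->
  @derives red_cfg [:: inl (inord (2 + (p * P + q)))]
    (tmR ((inord x :: v1 ++ [:: inord (d + z)]) ++
          inord (z + (d + 1)) :: v2 ++ [:: inord (d + y + (d + 1))])).
Proof.
move=> ltp ltq ltr ltx lty ltz f1 f2.
set k := r * PP + (p * P + q).
have ltpq : p * P + q < PP by exact: pair_lt.
have Em : k %% PP = p * P + q by rewrite modnMDl modn_small.
have Ed : k %/ PP = r by rewrite divnMDl ?muln_gt0 ?P0 // divn_small // addn0.
have Eq : (p * P + q) %% P = q by rewrite modnMDl modn_small.
have Ep : (p * P + q) %/ P = p by rewrite divnMDl // divn_small // addn0.
have pin : product_prod P k \in red_prods N d P L f.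
  rewrite inE !mem_cat; apply/orP; right; do 2 (apply/orP; right).
  apply/orP; left; apply: map_f; rewrite mem_iota /= add0n [PP * P]mulnC.
  exact: pair_lt.
have := red_step pin; cbn [map product_prod]; rewrite Em Ed Ep Eq.
have [k1 k2] := (pair_lt ltp ltr, pair_lt ltr ltq).
rewrite !sym_of_nt ?vcode_lt // => H; apply: derives_trans H _.
have H1 := @entry_derives false (p * P + r) x z v1 k1 ltx ltz.
have H2 := @entry_derives true (r * P + q) z y v2 k2 ltz lty.
rewrite !divnMDl // !modnMDl !modn_small // !divn_small // !addn0 in H1 H2.
have {}H1 := H1 f1; have {}H2 := H2 f2; rewrite mul1n in H2.
apply: derives_trans (@derives_ctx red_cfg [::] [:: _] _ _ H1) _.
rewrite {2}/tm map_cat -/(tmR _) -/(tmR _).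
have := @derives_ctx red_cfg (tmR (inord x :: v1 ++ [:: inord (d + z)])) [::] _ _ H2.
by rewrite !cats0.
Qed.

(** Positions count from 1 and letters from 0: the last letter [d + d + 1 + y] stands at position
    [d + d + 2 + y]. *)
Lemma red_substrE x y : y < d -> x < d ->
  @substr red_cfg red_string x.+1 (d + d + 2 + y) = map inord (iota x (d + d + 2 + y - x)).
Proof.
move=> lty ltx; rewrite /substr /red_string succnK -map_take -map_drop take_iota drop_iota.
by rewrite add0n (minn_idPl _) //; lia.
Qed.

(** The two implications are shaped after the two clauses of [c_oracle]: a witness yields
    c-derivation, and mere derivation already yields a witness. The oracle is thus forced both
    ways. *)
Lemma red_cfg_correct p q x y :
    p < P -> q < P -> x < d -> y < d ->
  let C := inord (2 + (p * P + q)) : 'I_(nonterms red_cfg) in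
  (hit d P f p q x y -> @c_derives red_cfg red_string C x.+1 (d + d + 2 + y)) /\
  (@derives_sub red_cfg red_string C x.+1 (d + d + 2 + y) -> hit d P f p q x y).
Proof.
move=> ltp ltq ltx lty C; have ltpq : p * P + q < PP by exact: pair_lt.
split=> [[u [ltu f1 f2]]|].
  split; last first.
    have -> : start red_cfg = A0 by apply: val_inj; rewrite /= inordK.
    exact: context_derives.
  have ltr : u %/ d < P by rewrite ltn_divLR.
  have ltz : u %% d < d by rewrite ltn_mod.
  rewrite {1}(divn_eq u d) in f1; rewrite {1}(divn_eq u d) in f2.
  rewrite /derives_sub red_substrE // (iota_entries ltx lty ltz).
  rewrite map_cat /= !map_cat /=.
  exact: product_derives f1 f2.
move/(derives_sound (@red_closed)).
rewrite /= inordK; last by lia.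
rewrite red_substrE // val_inord_iota; last by lia.
exact: product_lang_hit.
Qed.

End ReductionCfg.

Lemma red_grammar N d P L f : 0 < d -> 0 < P -> 3 * d < N ->
  exists (G : cfg) (w : seq 'I_(terms G)),
  [/\ nonterms G = num_nonterms P,
      cfg_code G = [:: num_nonterms P; N; 0; 2 + N + P * P + P * P * P + 2 * (P * P * (d * d))]
        ++ flatten [seq p.1 :: size p.2 :: p.2 | p <- red_prods N d P L f],
      cfg_size G = 2 + 3 * N + 3 * (P * P) + 3 * (P * P * P) + 8 * (P * P * (d * d)) + L,
      map val w = iota 0 N &
      forall p q x y (C : 'I_(nonterms G)), p < P -> q < P -> x < d -> y < d ->
        val C = 2 + (p * P + q) ->
        (hit d P f p q x y -> c_derives w C x.+1 (d + d + 2 + y)) /\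
        (derives_sub w C x.+1 (d + d + 2 + y) -> hit d P f p q x y)].
Proof.
case: N => [|N'] d0 P0 dN; first by lia.
exists (red_cfg L f d0 P0 dN), (red_string N'); split=> //.
- by rewrite cfg_code_num size_red_prods.
- by rewrite cfg_size_num sumn_red_prods.
- by rewrite val_inord_iota.
move=> p q x y C ltp ltq ltx lty EC.
have -> : C = inord (2 + (p * P + q)).
  by apply: val_inj; rewrite EC /= inordK //; have := pair_lt ltp ltq; lia.
exact: red_cfg_correct.
Qed.

(** * Expressions and loops on normal-form stores *)

(* The normal form of a store during the reduction: arrays 0 to 2 hold the input
   and are never written, array 3 the output, array 4 a list of scratch
   registers, and array [a.+5] is array [a] of [ps], which the renamed copies of
   the parser share. *)
Definition mk (inp : store) (sc : seq nat) (out : nat -> nat) (ps : store) : store :=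
  fun a => match a with
           | 0 | 1 | 2 => inp a
           | 3 => out
           | 4 => nth 0 sc
           | a'.+1.+4 => ps a'
           end.

Lemma upd_scratch inp sc out ps i v :
  upd (mk inp sc out ps) 4 i v = mk inp (set_nth 0 sc i v) out ps.
Proof.
apply: functional_extensionality => a; apply: functional_extensionality => j.
by rewrite /upd /mk; do 5?[case: a => [|a] //]; rewrite nth_set_nth.
Qed.

Lemma upd_out inp sc out ps i v :
  upd (mk inp sc out ps) 3 i v = mk inp sc (fun j => if j == i then v else out j) ps.
Proof.
apply: functional_extensionality => a; apply: functional_extensionality => j.
by rewrite /upd /mk; do 5?[case: a => [|a] //].
Qed.

Lemma upd_parser inp sc out ps a i v :
  upd (mk inp sc out ps) a.+1.+4 i v = mk inp sc out (upd ps a i v).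
Proof.
apply: functional_extensionality => a'; apply: functional_extensionality => j.
by rewrite /upd /mk; do 5?[case: a' => [|a'] //].
Qed.

(** Left shift must be left out: its value can be exponential in its operands, which would break
    [arith_bound]. *)
Definition arith (o : binop) : bool :=
  match o with Add | Defs.Sub | Mul | Div | Mod | Eqb | Ltb => true | _ => false end.

(** The predicate [pr] says which registers may be read. Loop bounds use [leq 2], so that neither
    counter nor writing position can change them; emitted values use [predC1 1], so that they cannot
    depend on the writing position. *)
Fixpoint pure (pr : pred nat) (e : expr) : bool :=
  match e with
  | Lit _ => true
  | Get 4 (Lit i) => pr i
  | Get a e1 => (a < 3) && pure pr e1
  | Bin o e1 e2 => [&& arith o, pure pr e1 & pure pr e2]
  end.

Fixpoint den (inp : store) (sc : seq nat) (e : expr) : nat :=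
  match e with
  | Lit n => n
  | Get a e1 => match a with
                | 0 | 1 | 2 => inp a (den inp sc e1)
                | _ => nth 0 sc (den inp sc e1)
                end
  | Bin o e1 e2 => binop_fun o (den inp sc e1) (den inp sc e2)
  end.

(** The exponent in the bound [den inp sc e + 2 <= M.+2 ^ deg e]. For a literal [n], the exponent
    [n.+1] suffices since the base is at least 2; a cell is at most [M], so the exponent of its
    index covers it. *)
Fixpoint deg (e : expr) : nat :=
  match e with
  | Lit n => n.+1
  | Get _ e1 => deg e1
  | Bin _ e1 e2 => deg e1 + deg e2
  end.

Lemma deg_gt0 e : 0 < deg e.
Proof. by elim: e => //= o e1 H1 e2 _; rewrite addn_gt0 H1. Qed.

Lemma pure_get pr a e : pure pr (Get a e) -> pure pr e /\ (a < 3 \/ a = 4).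
Proof.
case: e => [n|b e|o e1 e2]; do 5?[case: a => [|a] //=];
  by move=> H; split=> //; (left + right).
Qed.

Lemma pure_sub pr pr' e : subpred pr pr' -> pure pr e -> pure pr' e.
Proof.
move=> sub; elim: e => //= [a e IHe|o e1 IH1 e2 IH2].
  case: e IHe => [n|a' e|o e1 e2] IHe; last first.
  - by do 5?[case: a => [|a] //].
  - by do 5?[case: a => [|a] //].
  - by do 5?[case: a => [|a] //]; exact: sub.
by case/and3P=> -> /IH1-> /IH2->.
Qed.

Lemma den_ext pr inp sc sc' e : pure pr e ->
  (forall i, pr i -> nth 0 sc i = nth 0 sc' i) -> den inp sc e = den inp sc' e.
Proof.
move=> + E; elim: e => //= [a e IHe|o e1 IH1 e2 IH2].
  case: e IHe => [n|a' e|o e1 e2] IHe.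
  - by do 5?[case: a => [|a] //]; exact: E.
  - by do 5?[case: a => [|a] //]; move/IHe->.
  - by do 5?[case: a => [|a] //]; move/IHe->.
by case/and3P=> _ /IH1-> /IH2->.
Qed.

(* Since [x + y] and [x * y] are at most [(x + 2) * (y + 2) - 2], degrees add up. *)
Lemma arith_bound o x y : arith o -> binop_fun o x y + 2 <= (x + 2) * (y + 2).
Proof.
have Hd := leq_div x y; have Hm := leq_mod x y.
by case: o => //= _; nia.
Qed.

Section Evaluation.
Variables (M W : nat) (inp : store) (out : nat -> nat) (ps : store).
Hypothesis inpM : forall a i, a < 3 -> inp a i <= M.

Lemma eval_pure_bound pr sc e : all (leq^~ M) sc -> pure pr e -> M.+2 ^ deg e <= W ->
  eval W (mk inp sc out ps) e = Some (den inp sc e) /\ den inp sc e + 2 <= M.+2 ^ deg e.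
Proof.
move=> scM; have {}scM i : nth 0 sc i <= M.
  case: (ltnP i (size sc)) => Hi; last by rewrite nth_default.
  exact: (allP scM) (mem_nth _ Hi).
have ok v n : v + 2 <= M.+2 ^ n -> M.+2 ^ n <= W -> word W v = Some v.
  by rewrite /word => Hv HW; rewrite ifT //; lia.
have cell v n : v <= M -> 0 < n -> v + 2 <= M.+2 ^ n.
  move=> vM n0; apply: (@leq_trans (M.+2 ^ 1)); first by rewrite expn1; lia.
  by rewrite leq_exp2l.
elim: e => [n|a e IHe|o e1 IH1 e2 IH2] /=.
- have H : n + 2 <= M.+2 ^ n.+1.
    by elim: n => [|n IHn]; rewrite ?expn1 // expnS; nia.
  by move=> _ HW; rewrite (ok _ _ H HW).
- move=> pe HW.
  have [pe' Ha] := pure_get pe; have [E _] := IHe pe' HW; rewrite E.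
  have X : mk inp sc out ps a (den inp sc e) =
     match a with 0 | 1 | 2 => inp a (den inp sc e) | _ => nth 0 sc (den inp sc e) end.
    by case: Ha => [|-> //]; move: (a) => [|[|[|]]].
  have Y : mk inp sc out ps a (den inp sc e) + 2 <= M.+2 ^ deg e.
    rewrite X; apply: cell; last exact: deg_gt0.
    by case: Ha => [|-> //]; move: (a) => [|[|[|]]] // _; rewrite inpM.
  by rewrite -X (ok _ _ Y HW).
- case/and3P=> ao p1 p2 HW.
  have D1 : M.+2 ^ deg e1 <= W by apply: leq_trans HW; rewrite leq_exp2l // leq_addr.
  have D2 : M.+2 ^ deg e2 <= W by apply: leq_trans HW; rewrite leq_exp2l // leq_addl.
  have [-> B1] := IH1 p1 D1; have [-> B2] := IH2 p2 D2.
  have B : binop_fun o (den inp sc e1) (den inp sc e2) + 2 <= M.+2 ^ (deg e1 + deg e2).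
    by apply: leq_trans (arith_bound _ _ ao) _; rewrite expnD leq_mul.
  by rewrite (ok _ _ B HW).
Qed.

Lemma eval_pure pr D sc e : all (leq^~ M) sc -> pure pr e -> deg e <= D ->
  M.+2 ^ D <= W -> eval W (mk inp sc out ps) e = Some (den inp sc e).
Proof.
move=> scM pe eD DW.
have DW' : M.+2 ^ deg e <= W by apply: leq_trans DW; rewrite leq_exp2l.
by have [] := eval_pure_bound scM pe DW'.
Qed.

End Evaluation.

(* Scratch register 0 is the loop counter and register 1 the position at which
   the next value is written. *)
Definition reg i := Get 4 (Lit i).
Notation ve := (reg 0).
Notation vp := (reg 1).

Definition emit (t : nat) (es : seq expr) : cmd :=
  foldr (fun ex c => Seq (Put t.+1.+4 vp ex) (Seq (Put 4 (Lit 1) (Bin Add vp (Lit 1))) c))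
    (Put 4 (Lit 0) (Bin Add ve (Lit 1))) es.

(** A segment is a list comprehension: a bound and a row of expressions in the counter. The grammar
    code is a concatenation of these because its layout does not depend on the matrix entries. *)
Definition segment (t : nat) (s : expr * seq expr) : cmd :=
  Seq (Put 4 (Lit 0) (Lit 0)) (While (Bin Ltb ve s.1) (emit t s.2)).

Definition segments t (ss : seq (expr * seq expr)) : cmd :=
  foldr (fun s c => Seq (segment t s) c) Skip ss.

Definition emit_cost (es : seq expr) := sumn [seq ecost ex + 10 | ex <- es] + 10.
Definition segment_cost (s : expr * seq expr) := emit_cost s.2 + ecost s.1 + 10.
Definition segments_cost ss := sumn (map segment_cost ss) + 1.

Definition with_array (ps : store) t (l : seq nat) : store :=
  fun a => if a == t then nth 0 l else ps a.

Lemma upd_with_array ps t l v :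
  upd (with_array ps t l) t (size l) v = with_array ps t (rcons l v).
Proof.
apply: functional_extensionality => a; apply: functional_extensionality => j.
rewrite /upd /with_array; case: eqP => //= _; rewrite nth_rcons.
by case: ltngtP => // H; rewrite nth_default // ltnW.
Qed.

(** The strict inequality leaves one degree for the counter in the loop test. Rows are nonempty so
    that the length of the output bounds the counter and the number of rounds. *)
Definition segment_ok D (s : expr * seq expr) : bool :=
  [&& pure (leq 2) s.1, deg s.1 < D, 0 < size s.2 &
     all (fun ex => pure (predC1 1) ex && (deg ex <= D)) s.2].

Section Segments.
Variables (D M W : nat) (inp : store) (out : nat -> nat) (ps : store).
Variables (t : nat) (pars : seq nat).
Hypotheses (inpM : forall a i, a < 3 -> inp a i <= M) (D4 : 4 <= D).
Hypothesis DW : M.+2 ^ D <= W.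

Lemma exec_reg pr sc i ex ps' : all (leq^~ M) sc -> pure pr ex -> deg ex <= D -> i < D ->
  exec W (Put 4 (Lit i) ex) (mk inp sc out ps')
    (mk inp (set_nth 0 sc i (den inp sc ex)) out ps') (ecost ex).+2.
Proof.
move=> scM pex dex iD; rewrite -upd_scratch.
apply: (@ExecPut W 4 (Lit i)); last exact: (eval_pure _ _ inpM scM pex dex DW).
by apply: (@eval_pure M W inp out ps' inpM predT D).
Qed.

Lemma exec_set pr e p sc i ex ps' : all (leq^~ M) [:: e, p & sc] ->
  pure pr ex -> deg ex <= D -> i < 3 ->
  exec W (Put 4 (Lit i) ex) (mk inp [:: e, p & sc] out ps')
    (mk inp (set_nth 0 [:: e, p & sc] i (den inp [:: e, p & sc] ex)) out ps') (ecost ex).+2.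
Proof. by move=> scM pex dex i3; apply: exec_reg scM pex dex _; lia. Qed.

Hypothesis parsM : all (leq^~ M) pars.

Definition values es e := [seq den inp (e :: 0 :: pars) ex | ex <- es].

Definition segment_values (s : expr * seq expr) :=
  flatten [seq values s.2 e | e <- iota 0 (den inp (0 :: 0 :: pars) s.1)].

Definition segments_values ss := flatten (map segment_values ss).

Definition st e l := mk inp [:: e, size l & pars] out (with_array ps t l).

Lemma eval_st pr e l ex : e <= M -> size l <= M -> pure pr ex -> deg ex <= D ->
  eval W (st e l) ex = Some (den inp [:: e, size l & pars] ex).
Proof.
by move=> eM lM pex dex; apply: (eval_pure _ _ inpM _ pex dex DW); rewrite /= eM lM.
Qed.

Lemma exec_emit e l es : e <= M -> size l + size es <= M ->
    all (fun ex => pure (predC1 1) ex && (deg ex <= D)) es ->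
  exists n, n <= emit_cost es /\
    exec W (emit t es) (st e l) (st e.+1 (l ++ values es e)) n.
Proof.
move=> eM; elim: es l => [|ex es IHes] l /=.
  rewrite addn0 cats0 => lM _; exists (ecost (Bin Add ve (Lit 1))).+2; split=> //.
  by rewrite -[e.+1]addn1; apply: (@exec_set predT) => //; [rewrite /= eM lM|exact: ltnW D4].
move=> lM /andP[/andP[pex dex] ok].
have lM' : size l <= M by lia.
have [|n [Hn X]] := IHes (rcons l (den inp [:: e, 0 & pars] ex)) _ ok.
  by rewrite size_rcons; lia.
exists ((ecost vp + ecost ex).+1 + ((ecost (Bin Add vp (Lit 1))).+2 + n)); split.
  by rewrite /emit_cost /=; rewrite /emit_cost in Hn; lia.
apply: ExecSeq.
  apply: (@ExecPut W t.+1.+4 vp ex).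
    by apply: (@eval_st predT) => //=; lia.
  exact: (@eval_st (predC1 1)).
rewrite /st upd_parser upd_with_array.
have -> : den inp [:: e, size l & pars] ex = den inp [:: e, 0 & pars] ex.
  by apply: (den_ext inp pex) => -[|[|]].
apply: ExecSeq.
  by apply: (@exec_set predT) => //; rewrite /= eM lM'.
have -> : den inp [:: e, size l & pars] (Bin Add vp (Lit 1)) =
    size (rcons l (den inp [:: e, 0 & pars] ex)) by rewrite /= addn1 size_rcons.
by rewrite -cat_rcons; exact: X.
Qed.

Lemma exec_segment e0 l s : e0 <= M -> segment_ok D s ->
    size (l ++ segment_values s) <= M ->
  exists e n, [/\ e <= M, n <= segment_cost s * (size (segment_values s)).+1 &
    exec W (segment t s) (st e0 l) (st e (l ++ segment_values s)) n].
Proof.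
case: s => c es e0M /and4P[/= pc dc es1 ok]; rewrite /segment_values /segment /=.
set cnt := den _ _ c; set part := fun i => flatten [seq values es e | e <- iota 0 i].
rewrite -/(part cnt) size_cat => lM.
have size_part i : size (part i) = i * size es.
  rewrite size_flatten /shape -map_comp.
  rewrite (eq_map (g := fun=> size es)); last by move=> i' /=; rewrite size_map.
  by elim: i 0 => //= i IHi j; rewrite IHi mulSn.
have part0 : part 0 = [::] by [].
have partS i : part i.+1 = part i ++ values es i.
  by rewrite /part -addn1 iotaD map_cat flatten_cat /= cats0.
clearbody part; have cntM : cnt <= size (part cnt) by rewrite size_part leq_pmulr.
have part_le i : i <= cnt -> size (l ++ part i) <= M.
  by rewrite size_cat !size_part => Hi; apply: leq_trans lM; rewrite leq_add2l size_part leq_mul2r Hi orbT.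
have evalc e : e <= cnt ->
    eval W (st e (l ++ part e)) (Bin Ltb ve c) = Some (nat_of_bool (e < cnt)).
  move=> Hi; rewrite (@eval_st predT) ?part_le //=; try lia.
  - by rewrite /cnt (den_ext (sc' := [:: 0, 0 & pars]) inp pc) // => -[|[|]].
  - by apply: pure_sub pc.
have [i _ Hi ->|_ ->|i _ Hi ->|s' [n [X Hn Es]]] :=
  @exec_for W (fun i s => s = st i (l ++ part i)) (Bin Ltb ve c)
    (emit t es) cnt (emit_cost es) _ _ _ _ erefl.
- by rewrite evalc ?Hi // ltnW.
- by rewrite evalc // ltnn.
- have [||n [Hn X]] := @exec_emit i (l ++ part i) es _ _ ok; first lia.
    by have := part_le i.+1 Hi; rewrite !size_cat !size_part mulSn; lia.
  exists (st i.+1 (l ++ part i.+1)), n; split=> //.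
  by rewrite partS catA; exact: X.
- exists cnt, (3 + n); split; first lia.
    by rewrite /segment_cost /=; rewrite /= in Hn; nia.
  rewrite -Es; apply: ExecSeq X.
  have := @exec_set predT e0 (size l) pars 0 (Lit 0) (with_array ps t l).
  rewrite /st part0 cats0; apply=> //; first by rewrite /= e0M; apply/andP; split=> //; move: lM; lia.
  exact: leq_trans D4.
Qed.

Lemma exec_segments e0 l ss : e0 <= M -> all (segment_ok D) ss ->
    size (l ++ segments_values ss) <= M ->
  exists e n, [/\ e <= M, n <= segments_cost ss * (size (segments_values ss)).+1 &
    exec W (segments t ss) (st e0 l) (st e (l ++ segments_values ss)) n].
Proof.
elim: ss e0 l => [|s ss IHss] e0 l e0M /=.
  by move=> _ _; exists e0, 1; split=> //; rewrite /segments_values /= cats0; exact: ExecSkip.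
case/andP=> oks okss; rewrite /segments_values /= -/(segments_values ss) catA => lM.
have lM' : size (l ++ segment_values s) <= M.
  by apply: leq_trans lM; rewrite [leqRHS]size_cat leq_addr.
have [e1 [n1 [e1M Hn1 X1]]] := exec_segment e0M oks lM'.
have [e2 [n2 [e2M Hn2 X2]]] := IHss _ _ e1M okss lM.
exists e2, (n1 + n2); split=> //; last exact: ExecSeq X1 X2.
by rewrite size_cat /segments_cost /=; rewrite /segments_cost in Hn2; nia.
Qed.

End Segments.

(** * The programs *)

Declare Scope machine_scope.
Delimit Scope machine_scope with M.
Notation "x + y" := (Bin Add x y) : machine_scope.
Notation "x - y" := (Bin Defs.Sub x y) : machine_scope.
Notation "x * y" := (Bin Mul x y) : machine_scope.
Notation "x %/ y" := (Bin Div x y) : machine_scope.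
Notation "x %% y" := (Bin Mod x y) : machine_scope.
Notation "x == y" := (Bin Eqb x y) : machine_scope.
Notation "x < y" := (Bin Ltb x y) : machine_scope.
Notation "$ n" := (Lit n) (at level 1, n at level 1, format "$ n") : machine_scope.
Bind Scope machine_scope with expr.
Arguments Bin o (_ _)%_machine_scope.
Arguments Put _ (_ _)%_machine_scope.

Notation vN := (reg 2).
Notation vd := (reg 3).
Notation vP := (reg 4).
Notation vL := (reg 5).
Notation vm := (Get 0 (Lit 0)).

Definition segments_pure (ss : seq (expr * seq expr)) : bool :=
  all (fun s => [&& pure (leq 2) s.1, 0 < size s.2 & all (pure (predC1 1)) s.2]) ss.

Definition segments_deg (ss : seq (expr * seq expr)) : nat :=
  sumn [seq deg s.1 + sumn (map deg s.2) | s <- ss].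

Lemma leq_sumn_map (T : Type) (g : T -> nat) (D : nat) (s : seq T) :
  sumn (map g s) <= D -> all (fun x => g x <= D) s.
Proof. by elim: s => //= x s IHs H; rewrite IHs ?andbT; lia. Qed.

Lemma segments_ok D ss : segments_pure ss -> segments_deg ss < D ->
  all (segment_ok D) ss.
Proof.
rewrite /segments_deg; elim: ss => //= s ss IHss /andP[/and3P[p1 p2 p3] pss] H.
rewrite IHss ?andbT //; last by lia.
rewrite /segment_ok p1 p2 /=; apply/andP; split; first lia.
have /leq_sumn_map : sumn (map deg s.2) <= D by lia.
by elim: (s.2) p3 => //= ex es IHes /andP[-> /IHes H1] /andP[-> /H1].
Qed.
Section Code.
Variables (b I J K : nat).

Definition row_res (t : bool) := if t then K else I.
Definition col_res (t : bool) := if t then J else K.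

(** The blocks may reach beyond [m], so submatrices are extended by 0. Without the test on the
    column, the row-major index would run into the next row. *)
Definition block (inp : store) m (t : bool) u v : bool :=
  [&& u * b + row_res t < m, v * b + col_res t < m &
      inp t.+1 ((u * b + row_res t) * m + (v * b + col_res t)) == 1].

Definition ePP : expr := (vP * vP)%M.
Definition edd : expr := (vd * vd)%M.
Definition ent : expr := ($2 + $5 * ePP)%M.
Definition evcode (t : bool) (k c : expr) : expr :=
  ($2 + ePP + (($t * ePP + k) * $2 + c))%M.

(** Conjunction is multiplication: the cell is read even out of range, and the range tests then
    annihilate it. *)
Definition eblock (t : bool) (u v : expr) : expr :=
  let row := (u * $b + $(row_res t))%M in
  let col := (v * $b + $(col_res t))%M in
  ((row < vm) * ((col < vm) * (Get t.+1 (row * vm + col) == $1)))%M.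

Definition entry_segment (t : bool) : expr * seq expr :=
  let k := (ve %/ vd %/ vd)%M in
  let x := (ve %/ vd %% vd)%M in
  let z := (ve %% vd)%M in
  (ePP * edd,
   [:: evcode t k (eblock t (k %/ vP * vd + x) (k %% vP * vd + z)); $3;
       ent + (x + $t * (vd + $1)); $0; ent + (vd + z + $t * (vd + $1))])%M.

(** The last two zeros of the first segment encode the empty production of W. The padding production
    takes two segments, since its length is known only at run time. *)
Definition grammar_segments : seq (expr * seq expr) :=
  [:: ($1, [:: ent; vN; $0;
       $2 + vN + ePP + ePP * vP + $2 * (ePP * edd); $0; $0]);
      (vN, [:: $0; $2; ent + ve; $0]);
      (ePP, [:: $0; $2; $2 + ve; $0]);
      (ePP * vP, [:: $2 + ve %% ePP; $2;
         evcode false (ve %% ePP %/ vP * vP + ve %/ ePP) $1;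
         evcode true (ve %/ ePP * vP + ve %% ePP %% vP) $1]);
      entry_segment false; entry_segment true;
      ($1, [:: $1; vL]); (vL, [:: ent])]%M.

Definition string_segments : seq (expr * seq expr) := [:: ($1, [:: vN]); (vN, [:: ve])]%M.

Variables (inp : store) (m N d P L : nat).
Hypothesis inp_m : inp 0 0 = m.
Notation pars := [:: N; d; P; L].

Lemma string_valuesE : segments_values inp pars string_segments = N :: iota 0 N.
Proof.
rewrite /segments_values /segment_values /values /= cats0; congr cons.
by elim: N 0 => //= n IHn i; rewrite IHn.
Qed.

Notation code p := (p.1 :: size p.2 :: p.2).

Lemma entry_valuesE t : segment_values inp pars (entry_segment t) =
  flatten [seq code p | p <- map (entry_prod d P (block inp m) t) (iota 0 (P * P * (d * d)))].
Proof.
rewrite /segment_values -map_comp; congr flatten; apply: eq_map => e /=.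
by rewrite inp_m !mulnb; case: t.
Qed.

Lemma grammar_valuesE : segments_values inp pars grammar_segments =
  [:: num_nonterms P; N; 0; 2 + N + P * P + P * P * P + 2 * (P * P * (d * d))]
    ++ flatten [seq code p | p <- red_prods N d P L (block inp m)].
Proof.
rewrite /segments_values /red_prods /grammar_segments.
cbn [map flatten foldr]; rewrite -/(flatten _) !map_cat !flatten_cat -!entry_valuesE.
rewrite -!map_comp -!catA; congr (_ ++ _).
do 5 congr (_ ++ _).
congr (_ ++ _); rewrite /= !cats0 size_nseq; do 2 congr cons.
have flatten_const x n i : flatten [seq [:: x] | e <- iota i n] = nseq n x :> seq nat.
  by elim: n i => //= n IHn i; rewrite IHn.
by rewrite -(flatten_const _ _ 0).
Qed.

Lemma string_segments_pure : segments_pure string_segments.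
Proof. by []. Qed.

Lemma grammar_segments_pure : segments_pure grammar_segments.
Proof. by []. Qed.

End Code.

(** * Interleaved storage of the parser copies, by residues of array names modulo [R] *)

Section Slices.
Variable R : nat.

Definition slice r (ps : store) : store := fun a => ps (a * R + r).
Definition copy_array r a := (a * R + r).+1.+4.

Lemma slot_inj r r' a a' : r < R -> r' < R ->
  a * R + r = a' * R + r' -> a = a' /\ r = r'.
Proof.
move=> ltr ltr' E; have R0 : 0 < R by lia.
have := congr1 (divn^~ R) E; rewrite !divnMDl // !divn_small // !addn0 => Ea.
by split=> //; move: E; rewrite Ea => /addnI.
Qed.

Lemma copy_array_inj r : r < R -> injective (copy_array r).
Proof. by move=> ltr a a' [/(slot_inj ltr ltr)[]]. Qed.

Lemma slice_upd r ps a i v : r < R ->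
  slice r (upd ps (a * R + r) i v) = upd (slice r ps) a i v.
Proof.
move=> ltr; apply: functional_extensionality => a'.
apply: functional_extensionality => j; rewrite /slice /upd.
by congr (if _ && _ then _ else _); apply/eqP/eqP => [/(slot_inj ltr ltr)[]|->].
Qed.

Lemma slice_upd_other r r' ps a i v : r < R -> r' < R -> r' <> r ->
  slice r' (upd ps (a * R + r) i v) = slice r' ps.
Proof.
move=> ltr ltr' ne; apply: functional_extensionality => a'.
apply: functional_extensionality => j; rewrite /slice /upd.
by case: eqP => // /(slot_inj ltr' ltr)[].
Qed.

Lemma slice_with_array r ps a l : r < R ->
  slice r (with_array ps (a * R + r) l) = with_array (slice r ps) a l.
Proof.
move=> ltr; apply: functional_extensionality => a'; rewrite /slice /with_array.
by congr (if _ then _ else _); apply/eqP/eqP => [/(slot_inj ltr ltr)[]|->].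
Qed.

Lemma slice_with_array_other r r' ps a l : r < R -> r' < R -> r' <> r ->
  slice r' (with_array ps (a * R + r) l) = slice r' ps.
Proof.
move=> ltr ltr' ne; apply: functional_extensionality => a'; rewrite /slice /with_array.
by case: eqP => // /(slot_inj ltr' ltr)[].
Qed.

Lemma with_array_nil ps t : ps t = (fun=> 0) -> with_array ps t [::] = ps.
Proof.
move=> E; apply: functional_extensionality => a; rewrite /with_array.
case: eqP => // ->; rewrite E; apply: functional_extensionality => j.
exact: nth_nil.
Qed.

Lemma exec_copy_rename W c s s' n r inp sc out ps : r < R ->
  exec W c s s' n -> slice r ps = s ->
  exists ps', [/\ exec W (rename (copy_array r) c) (mk inp sc out ps) (mk inp sc out ps') n,
    slice r ps' = s' & forall r', r' < R -> r' <> r -> slice r' ps' = slice r' ps].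
Proof.
move=> ltr X E.
have [|S' [X' E' F']] := @exec_rename _ (copy_array_inj ltr) _ _ _ _ _ (mk inp sc out ps) X.
  by rewrite -E.
exists (fun a => S' a.+1.+4); split.
- have -> : mk inp sc out (fun a => S' a.+1.+4) = S' => //.
  by apply: functional_extensionality => -[|[|[|[|[|a]]]]] //=; rewrite F'.
- by rewrite -E'.
- move=> r' ltr' ne; apply: functional_extensionality => a; rewrite /slice F' //.
  by move=> a' [/(slot_inj ltr' ltr)[]].
Qed.

End Slices.

(** * One parser run for one residue triple *)

Section Copy.
Variables (Q : parser) (k0 q : nat).
Hypothesis parserQ : forall (G : cfg) (w : seq 'I_(terms G)),
  exists s n F, let W := max_word k0 (parser_input_size w) n in
    [/\ exec W (prep Q) (parser_input w) s n, c_oracle w F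
      & serves W q (query Q) w s F].

(** Remembers that [nu] is the time of an actual parser run on an input of exactly these sizes; the
    assumed time bound is applied to it only at the end. *)
Definition prep_time (g N nu : nat) : Prop := exists (G : cfg) (w : seq 'I_(terms G)) W s,
  [/\ cfg_size G = g, size w = N & exec W (prep Q) (parser_input w) s nu].

Variables (b R I J K r : nat).
Hypotheses (b0 : 0 < b) (ltr : r < R).

Definition build : cmd :=
  Seq (Put 4 (Lit 1) (Lit 0)) (Seq (segments (0 * R + r) (grammar_segments b I J K))
    (Seq (Put 4 (Lit 1) (Lit 0)) (segments (1 * R + r) string_segments))).

Definition select : expr :=
  ((ve %/ vm %% $b == $I) * (ve %% vm %% $b == $J))%M.
Definition ask_nonterm : expr :=
  ($2 + (ve %/ vm %/ $b %/ vd * vP + ve %% vm %/ $b %/ vd))%M.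
Definition ask_left : expr := (ve %/ vm %/ $b %% vd + $1)%M.
Definition ask_right : expr := (vd + vd + $2 + ve %% vm %/ $b %% vd)%M.

(** Only ones are ever written, so the output accumulates the disjunction over all inner residues,
    each handled by a different copy. *)
Definition consult : cmd :=
  Seq (Put (copy_array R r 2) (Lit 0) ask_nonterm)
  (Seq (Put (copy_array R r 2) (Lit 1) ask_left)
  (Seq (Put (copy_array R r 2) (Lit 2) ask_right)
  (Seq (rename (copy_array R r) (query Q))
       (If (Get (copy_array R r 3) (Lit 0)) (Put 3 ve (Lit 1)) Skip)))).

Definition consult_all : cmd :=
  Seq (Put 4 (Lit 0) (Lit 0))
    (While (ve < vm * vm)%M
      (Seq (If select consult Skip) (Put 4 (Lit 0) (ve + $1)%M))).

Definition run_copy : cmd :=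
  Seq build (Seq (rename (copy_array R r) (prep Q)) consult_all).

Definition copy_deg := segments_deg (grammar_segments b I J K) + segments_deg string_segments
  + deg select + deg ask_nonterm + deg ask_left + deg ask_right + 10.

Definition consult_cost := 30 + ecost ask_nonterm + ecost ask_left + ecost ask_right + q.

Definition copy_cost := 100 + segments_cost (grammar_segments b I J K) +
  segments_cost string_segments + ecost select + consult_cost.

Definition contributes inp m n e : bool :=
  [&& e %/ m %% b == I, e %% m %% b == J &
     has (fun u => block b I J K inp m false (e %/ m %/ b) u &&
                   block b I J K inp m true u (e %% m %/ b)) (iota 0 n)].

Section Run.
Variables (inp : store) (m N d P L M W : nat).
Hypothesis inp_m : inp 0 0 = m.
Hypothesis inpM : forall a i, a < 3 -> inp a i <= M.
Hypotheses (d0 : 0 < d) (P0 : 0 < P) (dN : 3 * d < N) (m_le : m <= P * d * b).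
Notation size_g := (2 + 3 * N + 3 * (P * P) + 3 * (P * P * P) + 8 * (P * P * (d * d)) + L).
Hypotheses (gM : 4 + 2 * size_g <= M) (mM : m * m <= M).
Hypothesis (DW : M.+2 ^ copy_deg <= W).
Notation pars := [:: N; d; P; L].
Notation f := (block b I J K inp m).

Lemma parsM : all (leq^~ M) pars.
Proof. by rewrite /=; apply/and5P; split=> //; nia. Qed.

(** The code of a production has one cell more than its size, and every production has size at least
    1; the header takes four cells. *)
Lemma size_grammar_code : size (segments_values inp pars (grammar_segments b I J K)) <= 4 + 2 * size_g.
Proof.
rewrite (grammar_valuesE _ _ _ _ _ _ _ _ inp_m) size_cat size_flatten /shape -map_comp.
have : sumn [seq (size \o (fun p => p.1 :: size p.2 :: p.2)) p | p <- red_prods N d P L f] =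
  sumn [seq (size p.2).+1 | p <- red_prods N d P L f] + size (red_prods N d P L f).
  by elim: (red_prods _ _ _ _ _) => //= p ps ->; lia.
by rewrite sumn_red_prods size_red_prods /= => ->; lia.
Qed.

(** The slice has to be blank because [parser_input] is 0 outside its two arrays. *)
Lemma exec_build e0 p0 out ps : e0 <= M -> p0 <= M -> slice R r ps = (fun _ _ => 0) ->
  exists e1 n, [/\ e1 <= M,
    n <= (segments_cost (grammar_segments b I J K) + segments_cost string_segments + 8) * (5 + 2 * size_g) &
    exec W build (mk inp [:: e0, p0 & pars] out ps)
      (mk inp [:: e1, N.+1 & pars] out
         (with_array (with_array ps (0 * R + r) (segments_values inp pars (grammar_segments b I J K)))
            (1 * R + r) (N :: iota 0 N))) n].
Proof.
move=> e0M p0M E0.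
have psE a : ps (a * R + r) = (fun=> 0) by rewrite -/(slice R r ps a) E0.
have D4 : 4 <= copy_deg by rewrite /copy_deg; lia.
have okg : all (segment_ok copy_deg) (grammar_segments b I J K).
  by apply: segments_ok (grammar_segments_pure _ _ _ _) _; rewrite /copy_deg; lia.
have oks : all (segment_ok copy_deg) string_segments.
  by apply: segments_ok string_segments_pure _; rewrite /copy_deg; lia.
have pM := parsM; have sg := size_grammar_code.
set gv := segments_values inp pars (grammar_segments b I J K) in sg *.
have sgM : size ([::] ++ gv) <= M by apply: leq_trans sg gM.
have X1 := @exec_set _ _ _ _ out inpM D4 DW predT e0 p0 pars 1 (Lit 0) ps.
have [e1 [n1 [e1M Hn1 X2]]] := @exec_segments _ _ _ _ out ps (0 * R + r) pars
  inpM D4 DW pM e0 [::] (grammar_segments b I J K) e0M okg sgM.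
set ps1 := with_array ps (0 * R + r) gv.
have X3 := @exec_set _ _ _ _ out inpM D4 DW predT e1 (size gv) pars 1 (Lit 0) ps1.
have sv := string_valuesE inp N d P L.
have svM : size ([::] ++ segments_values inp pars string_segments) <= M.
  by rewrite sv /= size_iota; lia.
have [e2 [n2 [e2M Hn2 X4]]] := @exec_segments _ _ _ _ out ps1 (1 * R + r) pars
  inpM D4 DW pM e1 [::] string_segments e1M oks svM.
exists e2, (3 + (n1 + (3 + n2))); split=> //.
  have Es : size (segments_values inp pars string_segments) = N.+1.
    by rewrite sv /= size_iota.
  rewrite Es in Hn2; rewrite -/gv in Hn1; move: sg Hn1 Hn2.
  set u := segments_cost _; set v := segments_cost _.
  set g := size_g => sg Hn1 Hn2; have gN : N <= g by rewrite /g; lia.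
  have gN2 : N.+2 <= 5 + 2 * g by lia.
  have H1 : u * (size gv).+1 <= u * (5 + 2 * g) by rewrite leq_mul2l; lia.
  have H2 : v * N.+2 <= v * (5 + 2 * g) by rewrite leq_mul2l gN2 orbT.
  by clearbody u v g; rewrite !mulnDl; lia.
rewrite /build; apply: ExecSeq.
  by apply: X1; rewrite //= ?e0M ?p0M.
rewrite [mk _ (set_nth _ _ _ _) _ _]/=.
apply: ExecSeq.
  move: X2; rewrite /st with_array_nil //; exact.
apply: ExecSeq.
  by apply: X3 => //; apply/and3P; split=> //; apply: leq_trans sg gM.
move: X4; rewrite /st sv /= size_iota with_array_nil; first exact.
have -> : ps1 (1 * R + r) = slice R r ps1 1 by [].
by rewrite slice_with_array // E0.
Qed.

Section Queries.
Variables (G : cfg) (w : seq 'I_(terms G)) (W' : nat) (s0 : store).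
Variable F : 'I_(nonterms G) -> nat -> nat -> bool.
Hypotheses (W'W : W' <= W) (orF : c_oracle w F) (servF : serves W' q (query Q) w s0 F).
Hypotheses (ntG : nonterms G = num_nonterms P) (sizew : size w = N).
Hypothesis corrG :
  forall p q x y (C : 'I_(nonterms G)), p < P -> q < P -> x < d -> y < d ->
    val C = 2 + (p * P + q) ->
    (hit d P f p q x y -> c_derives w C x.+1 (d + d + 2 + y)) /\
    (derives_sub w C x.+1 (d + d + 2 + y) -> hit d P f p q x y).

Lemma oracle_hit p p' x y (C : 'I_(nonterms G)) :
  p < P -> p' < P -> x < d -> y < d -> val C = 2 + (p * P + p') ->
  F C x.+1 (d + d + 2 + y) = has (fun u => f false (p * d + x) u && f true u (p' * d + y)) (iota 0 (P * d)).
Proof.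
move=> ltp ltp' ltx lty EC; have [H1 H2] := corrG ltp ltp' ltx lty EC.
have sub : is_substr w x.+1 (d + d + 2 + y) by rewrite /is_substr sizew; lia.
have [F1 F2] := orF C sub.
apply/idP/idP => [Ft|/hasP[u]].
  apply: contraT => /hasPn no.
  have /F2 : ~ derives_sub w C x.+1 (d + d + 2 + y).
    by move/H2 => [u [ltu f1 f2]]; have := no u; rewrite mem_iota f1 f2 => /(_ ltu).
  by rewrite Ft.
rewrite mem_iota => ltu /andP[f1 f2]; apply: F1; apply: H1.
by exists u.
Qed.

(** A query may alter the parser's own store, so what persists between queries is [consulted] rather
    than a fixed store. *)
Lemma exec_consult e p1 out ps : e < m * m -> p1 <= M ->
    e %/ m %% b = I -> e %% m %% b = J ->
    consulted W' (query Q) w s0 (slice R r ps) ->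
  exists ps' n, [/\ n <= consult_cost,
    exec W consult (mk inp [:: e, p1 & pars] out ps)
      (mk inp [:: e, p1 & pars]
         (fun j => if (j == e) && contributes inp m (P * d) e then 1 else out j) ps') n,
    consulted W' (query Q) w s0 (slice R r ps') &
    forall r', r' < R -> r' <> r -> slice R r' ps' = slice R r' ps].
Proof.
move=> lte p1M EI EJ cons.
have m0 : 0 < m by lia.
have lti : e %/ m < m by rewrite ltn_divLR.
have ltj : e %% m < m by rewrite ltn_mod.
set i := e %/ m in lti EI *; set j := e %% m in ltj EJ *.
have lt_blk k : k < m -> k %/ b < P * d by move=> H; rewrite ltn_divLR //; lia.
have ltp : i %/ b %/ d < P by rewrite ltn_divLR // lt_blk.
have ltp' : j %/ b %/ d < P by rewrite ltn_divLR // lt_blk.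
have ltx : i %/ b %% d < d by rewrite ltn_mod.
have lty : j %/ b %% d < d by rewrite ltn_mod.
have ltC : 2 + (i %/ b %/ d * P + j %/ b %/ d) < nonterms G.
  by rewrite ntG /num_nonterms; have := pair_lt ltp ltp'; lia.
have FE := @oracle_hit _ _ _ _ (Ordinal ltC) ltp ltp' ltx lty erefl.
rewrite -!divn_eq in FE.
have sub : is_substr w (i %/ b %% d).+1 (d + d + 2 + j %/ b %% d).
  by rewrite /is_substr sizew; lia.
have [s' [n [X nq ans]]] := servF (Ordinal ltC) cons sub.
set A := 2 + _ in ltC FE X ans.
set ps1 := upd (upd (upd ps (2 * R + r) 0 A) (2 * R + r) 1 (i %/ b %% d).+1)
  (2 * R + r) 2 (d + d + 2 + j %/ b %% d).
have E1 : slice R r ps1 = ask (slice R r ps) A (i %/ b %% d).+1 (d + d + 2 + j %/ b %% d).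
  by rewrite /ps1 !slice_upd.
have [ps' [X' E' O']] := exec_copy_rename inp [:: e, p1 & pars] out ltr (exec_mono W'W X) E1.
have W1 : 1 <= W by apply: leq_trans DW; rewrite expn_gt0.
have ev ex ps2 : pure predT ex -> deg ex <= copy_deg ->
    eval W (mk inp [:: e, p1 & pars] out ps2) ex = Some (den inp [:: e, p1 & pars] ex).
  move=> pex dex; apply: (eval_pure out ps2 inpM _ pex dex DW).
  by have := parsM; rewrite /= p1M => ->; rewrite !andbT; lia.
have ev_ans : eval W (mk inp [:: e, p1 & pars] out ps') (Get (copy_array R r 3) (Lit 0)) =
    Some (nat_of_bool (F (Ordinal ltC) (i %/ b %% d).+1 (d + d + 2 + j %/ b %% d))).
  rewrite /= /word /=; have -> : ps' (3 * R + r) 0 = answer s' by rewrite -E'.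
  by rewrite ans; case: F => /=; rewrite ?W1.
have outE : (fun k => if (k == e) && contributes inp m (P * d) e then 1 else out k) =
    (fun k => if (k == e) && F (Ordinal ltC) (i %/ b %% d).+1 (d + d + 2 + j %/ b %% d) then 1 else out k).
  by rewrite /contributes -/i -/j EI EJ !eqxx FE.
have [n4 [n4le X4]] : exists n4, n4 <= 7 /\
    exec W (If (Get (copy_array R r 3) (Lit 0)) (Put 3 ve (Lit 1)) Skip)
      (mk inp [:: e, p1 & pars] out ps')
      (mk inp [:: e, p1 & pars] (fun k => if (k == e) && contributes inp m (P * d) e then 1 else out k) ps') n4.
  rewrite outE; move: ev_ans; case: F => ev_ans.
    exists (((2 + 1).+1 + 2).+1); split=> //; apply: ExecIfTrue ev_ans _ _ => //.
    have -> : (fun k => if (k == e) && true then 1 else out k) = (fun k => if k == e then 1 else out k).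
      by apply: functional_extensionality => k; rewrite andbT.
    rewrite -upd_out; apply: ExecPut; first by rewrite ev //= /copy_deg; lia.
    by rewrite ev //= /copy_deg; lia.
  exists (1 + 2).+1; split=> //; apply: ExecIfFalse ev_ans _.
  have -> : (fun k => if (k == e) && false then 1 else out k) = out.
    by apply: functional_extensionality => k; rewrite andbF.
  exact: ExecSkip.
exists ps', ((1 + ecost ask_nonterm).+1 + ((1 + ecost ask_left).+1 +
  ((1 + ecost ask_right).+1 + (n + n4)))); split.
- by rewrite /consult_cost; lia.
- have degs : [&& deg ask_nonterm <= copy_deg, deg ask_left <= copy_deg & deg ask_right <= copy_deg].
    by rewrite /copy_deg; apply/and3P; split; lia.
  case/and3P: degs => dg1 dg2 dg3.
  have dgl c : c < 3 -> deg (Lit c) <= copy_deg by rewrite /copy_deg /=; lia.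
  apply: ExecSeq.
    by apply: (@ExecPut W (2 * R + r).+1.+4); [apply: ev => //; apply: dgl|apply: ev].
  rewrite upd_parser; apply: ExecSeq.
    by apply: (@ExecPut W (2 * R + r).+1.+4); [apply: ev => //; apply: dgl|apply: ev].
  rewrite upd_parser; apply: ExecSeq.
    by apply: (@ExecPut W (2 * R + r).+1.+4); [apply: ev => //; apply: dgl|apply: ev].
  rewrite upd_parser; apply: ExecSeq X4.
  have -> : den inp [:: e, p1 & pars] ask_nonterm = A by rewrite /= inp_m.
  have -> : den inp [:: e, p1 & pars] ask_left = (i %/ b %% d).+1 by rewrite /= inp_m addn1.
  have -> : den inp [:: e, p1 & pars] ask_right = d + d + 2 + j %/ b %% d by rewrite /= inp_m.
  exact: X'.
- by rewrite E'; apply: ConsultedS cons sub X.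
- by move=> r' lr' ne; rewrite O' // !slice_upd_other.
Qed.

Definition out_upto (out : nat -> nat) e : nat -> nat :=
  fun j => if (j < e) && contributes inp m (P * d) j then 1 else out j.

Lemma exec_consult_all e p1 out ps : e <= M -> p1 <= M ->
    consulted W' (query Q) w s0 (slice R r ps) ->
  exists ps' n, [/\ n <= (ecost select + consult_cost + 30) * (m * m).+1,
    exec W consult_all (mk inp [:: e, p1 & pars] out ps)
      (mk inp [:: m * m, p1 & pars] (out_upto out (m * m)) ps') n &
    forall r', r' < R -> r' <> r -> slice R r' ps' = slice R r' ps].
Proof.
move=> eM p1M cons.
have D4 : 4 <= copy_deg by rewrite /copy_deg; lia.
have ev e' out' ps2 ex : e' <= M -> pure predT ex -> deg ex <= copy_deg ->
    eval W (mk inp [:: e', p1 & pars] out' ps2) ex = Some (den inp [:: e', p1 & pars] ex).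
  move=> e'M pex dex; apply: (eval_pure out' ps2 inpM _ pex dex DW).
  by have := parsM; rewrite /= p1M e'M => ->.
pose Inv e' s := exists ps2, [/\ s = mk inp [:: e', p1 & pars] (out_upto out e') ps2,
  consulted W' (query Q) w s0 (slice R r ps2) &
  forall r', r' < R -> r' <> r -> slice R r' ps2 = slice R r' ps].
have evc e' out' ps2 : e' <= m * m -> eval W (mk inp [:: e', p1 & pars] out' ps2)
    (ve < vm * vm)%M = Some (nat_of_bool (e' < m * m)).
  by move=> le; rewrite ev ?(leq_trans le) //= inp_m.
have [e' s lte [ps2 [-> _ _]]|s [ps2 [-> _ _]]|e' s lte [ps2 [-> c2 O2]]||s [n [X nle [ps' [Es _ O']]]]] :=
  @exec_for W Inv (ve < vm * vm)%M
   (Seq (If select consult Skip) (Put 4 (Lit 0) (ve + $1)%M)) (m * m)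
   (ecost select + consult_cost + 10) _ _ _ (mk inp [:: 0, p1 & pars] out ps).
- by rewrite evc ?lte // ltnW.
- by rewrite evc // ltnn.
- have e'M : e' <= M by lia.
  have incr out' ps3 : exec W (Put 4 (Lit 0) (ve + $1)%M) (mk inp [:: e', p1 & pars] out' ps3)
      (mk inp [:: e'.+1, p1 & pars] out' ps3) 6.
    have := @exec_set _ _ _ _ out' inpM D4 DW predT e' p1 pars 0 (ve + $1)%M ps3.
    rewrite /= addn1; apply=> //.
    by have := parsM; rewrite /= e'M p1M.
  have evs : eval W (mk inp [:: e', p1 & pars] (out_upto out e') ps2) select =
      Some (nat_of_bool ((e' %/ m %% b == I) && (e' %% m %% b == J))).
    have degs : deg select <= copy_deg by rewrite /copy_deg; lia.
    by rewrite (ev _ _ _ _ e'M _ degs) //= inp_m mulnb.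
  have outS c : contributes inp m (P * d) e' = c ->
      out_upto out e'.+1 = (fun j => if (j == e') && c then 1 else out_upto out e' j).
    move=> <-; apply: functional_extensionality => j; rewrite /out_upto ltnS leq_eqVlt.
    by case: eqP => //= ->; rewrite ltnn /=.
  move: evs; case: eqP => [EI|nI]; first case: eqP => [EJ|nJ].
  + move=> evs.
    have [ps3 [n [nle X c3 O3]]] := exec_consult (out_upto out e') lte p1M EI EJ c2.
    exists (mk inp [:: e'.+1, p1 & pars] (out_upto out e'.+1) ps3), ((n + ecost select).+1 + 6).
    split; [|by lia|].
      rewrite (outS _ erefl); apply: ExecSeq (incr _ _).
      exact: ExecIfTrue evs _ X.
    exists ps3; split=> // r' lr' ne; by rewrite O3 ?O2.
  + move=> evs.
    exists (mk inp [:: e'.+1, p1 & pars] (out_upto out e'.+1) ps2), ((1 + ecost select).+1 + 6).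
    split; [|by lia|by exists ps2].
    rewrite (outS false); last by rewrite /contributes EI eqxx; case: eqP nJ.
    apply: ExecSeq; first exact: ExecIfFalse evs (ExecSkip _ _).
    have -> : (fun j => if (j == e') && false then 1 else out_upto out e' j) = out_upto out e'.
      by apply: functional_extensionality => j; rewrite andbF.
    exact: incr.
  + move=> evs.
    exists (mk inp [:: e'.+1, p1 & pars] (out_upto out e'.+1) ps2), ((1 + ecost select).+1 + 6).
    split; [|by lia|by exists ps2].
    rewrite (outS false); last by rewrite /contributes; case: eqP nI.
    apply: ExecSeq; first exact: ExecIfFalse evs (ExecSkip _ _).
    have -> : (fun j => if (j == e') && false then 1 else out_upto out e' j) = out_upto out e'.
      by apply: functional_extensionality => j; rewrite andbF.
    exact: incr.
- by exists ps; split=> //; congr mk; apply: functional_extensionality.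
rewrite Es in X; exists ps', (3 + n); split=> //.
  have Ec : ecost (ve < vm * vm)%M = 8 by [].
  by move: nle; rewrite Ec; nia.
apply: ExecSeq X.
have := @exec_set _ _ _ _ out inpM D4 DW predT e p1 pars 0 (Lit 0) ps.
by apply=> //; have := parsM; rewrite /= eM p1M.
Qed.

End Queries.

End Run.
(** The time [nu] is fixed before [W], since the words that the parser needs depend on [nu]. The
    lower bound [nu <= n] later keeps these words polynomial in the total time. *)
Lemma exec_run_copy (inp : store) m N d P L M :
    inp 0 0 = m -> (forall a i, a < 3 -> inp a i <= M) ->
    0 < d -> 0 < P -> 3 * d < N -> m <= P * d * b ->
    let g := 2 + 3 * N + 3 * (P * P) + 3 * (P * P * P) + 8 * (P * P * (d * d)) + L in
    4 + 2 * g <= M -> m * m <= M ->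
  exists2 nu, prep_time g N nu & forall W e0 p0 out ps,
    M.+2 ^ copy_deg <= W -> max_word k0 (num_nonterms P + N + g + N) nu <= W ->
    e0 <= M -> p0 <= M -> slice R r ps = (fun _ _ => 0) ->
  exists e1 p1 ps' n,
    [/\ exec W run_copy (mk inp [:: e0; p0; N; d; P; L] out ps)
          (mk inp [:: e1; p1; N; d; P; L] (out_upto inp m d P out (m * m)) ps') n,
        nu <= n <= nu + copy_cost * (5 + 2 * g + m * m),
        e1 <= M, p1 <= M &
        forall r', r' < R -> r' <> r -> slice R r' ps' = slice R r' ps].
Proof.
move=> inp_m inpM d0 P0 dN m_le g gM mM.
have [G [w [ntG codeG sizeG valw corrG]]] := red_grammar L (block b I J K inp m) d0 P0 dN.
have tmG : terms G = N by have := congr1 (nth 0 ^~ 1) codeG.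
have sizew : size w = N by rewrite -(size_map val) valw size_iota.
have sizeI : parser_input_size w = num_nonterms P + N + g + N.
  by rewrite /parser_input_size sizew sizeG ntG tmG.
have [s0 [nu [F]]] := parserQ w; rewrite sizeI /= => -[X orF servF].
exists nu; first by exists G, w, (max_word k0 (num_nonterms P + N + g + N) nu), s0.
move=> W e0 p0 out ps DW W'W e0M p0M E0.
have [e1 [n1 [e1M n1le X1]]] := exec_build inp_m inpM d0 P0 dN m_le gM mM DW out e0M p0M E0.
set ps1 := with_array _ _ _ in X1.
have E1 : slice R r ps1 = parser_input w.
  rewrite /ps1 !slice_with_array // E0 (grammar_valuesE _ _ _ _ _ _ _ _ inp_m) -codeG.
  have -> : N :: iota 0 N = size w :: map val w by rewrite valw sizew.
  by apply: functional_extensionality => -[|[|a]].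
have O1 r' : r' < R -> r' <> r -> slice R r' ps1 = slice R r' ps.
  by move=> lr' ne; rewrite /ps1 !slice_with_array_other.
have [ps2 [X2 E2 O2]] := exec_copy_rename inp [:: e1; N.+1; N; d; P; L] out ltr
  (exec_mono W'W X) E1.
have N1M : N.+1 <= M by lia.
have cons : consulted (max_word k0 (num_nonterms P + N + g + N) nu) (query Q) w s0
  (slice R r ps2) by rewrite E2; exact: Consulted0.
have [ps3 [n3 [n3le X3 O3]]] := exec_consult_all inp_m inpM d0 P0 dN m_le gM mM DW W'W
  orF servF ntG sizew corrG out e1M N1M cons.
exists (m * m), N.+1, ps3, (n1 + (nu + n3)); split=> //.
- by apply: ExecSeq X1 _; apply: ExecSeq X2 X3.
- move: n1le n3le; rewrite -/g /copy_cost.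
  set u := segments_cost _; set v := segments_cost _; set c := ecost select.
  set t := consult_cost; clearbody u v c t g; move=> n1le n3le; nia.
- by move=> r' lr' ne; rewrite O3 // O2 // O1.
Qed.

End Copy.

(** * Row-major input matrices *)

Section MatrixCode.
Variable m : nat.
Implicit Types A B : 'M[bool]_m.

Lemma nth_flatten_uniform (rows : seq (seq nat)) i j :
  all (fun row => size row == m) rows -> i < size rows -> j < m ->
  nth 0 (flatten rows) (i * m + j) = nth 0 (nth [::] rows i) j.
Proof.
move=> + + ltj; elim: rows i => //= row rows IH [|i] /andP[/eqP Er Ers] lti.
  by rewrite nth_cat Er mul0n add0n ltj.
rewrite nth_cat Er mulSn -addnA ltnNge leq_addr /= addKn. exact: IH.
Qed.

Lemma nth_matrix_code A (i j : 'I_m) : nth 0 (matrix_code A) (i * m + j) = A i j.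
Proof.
rewrite /matrix_code nth_flatten_uniform ?ltn_ord //.
- by rewrite (nth_map i) ?size_enum_ord // (nth_map j) ?size_enum_ord // !nth_ord_enum.
- by apply/allP=> _ /mapP[k _ ->]; rewrite size_map size_enum_ord.
- by rewrite size_map size_enum_ord.
Qed.

Lemma matrix_code_le1 A x : nth 0 (matrix_code A) x <= 1.
Proof.
have H : all (leq^~ 1) (matrix_code A).
  by apply/allP=> _ /allpairsP[[i j] [_ _ ->]] /=; case: (A i j).
case: (ltnP x (size (matrix_code A))) => [ltx|?]; last by rewrite nth_default.
exact: (allP H) (mem_nth _ ltx).
Qed.

Lemma bmm_input_le A B a x : a < 3 -> bmm_input A B a x <= maxn m 1.
Proof.
case: a => [|[|[|]]] //= _; last 2 first.
- exact: leq_trans (matrix_code_le1 _ _) (leq_maxr _ _).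
- exact: leq_trans (matrix_code_le1 _ _) (leq_maxr _ _).
by case: x => [|x]; rewrite /= ?nth_nil ?leq_maxl.
Qed.

Lemma bmm_inputE A B :
  bmm_input A B = mk (bmm_input A B) [:: 0; 0; 0; 0; 0; 0] (fun=> 0) (fun _ => fun=> 0).
Proof.
apply: functional_extensionality => -[|[|[|[|[|a]]]]] //.
by apply: functional_extensionality; do 7?[case=> //].
Qed.

End MatrixCode.

(** * Recombination of the residue classes into the full product *)

Section Product.
Variables (b m : nat) (A B : 'M[bool]_m).
Hypothesis b0 : 0 < b.

(** The three digits in base [b] of a copy number below [b * b * b] are the residues I, J, K. *)
Definition blk_row r := r %/ b %/ b.
Definition blk_col r := r %/ b %% b.
Definition blk_mid r := r %% b.

(** Only copies whose first two digits are the residues of [i] and [j] touch this cell; their third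
    digits sort the witnesses [k] by residue. *)
Lemma contributes_product n (i j : 'I_m) : m <= n * b ->
  has (fun r => contributes b (blk_row r) (blk_col r) (blk_mid r) (bmm_input A B) m n (i * m + j))
    (iota 0 (b * b * b)) = bool_mulmx A B i j.
Proof.
move=> mn; have m0 : 0 < m by case: (m) i => [[]|].
have Ei : (i * m + j) %/ m = i by rewrite divnMDl // divn_small ?addn0.
have Ej : (i * m + j) %% m = j by rewrite modnMDl modn_small.
rewrite mxE; apply/hasP/existsP => [[r _]|[k /andP[Aik Bkj]]].
  rewrite /contributes Ei Ej.
  case/and3P=> /eqP EI /eqP EJ /hasP[u _ /andP[]].
  rewrite /block /row_res /col_res -EI -EJ -!divn_eq => /and3P[_ ltk Eik] /and3P[_ _ Ekj].
  exists (Ordinal ltk); apply/andP; split.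
    have : nth 0 (matrix_code A) (i * m + Ordinal ltk) == 1 := Eik.
    by rewrite nth_matrix_code eqb1.
  have : nth 0 (matrix_code B) (Ordinal ltk * m + j) == 1 := Ekj.
  by rewrite nth_matrix_code eqb1.
pose r := (i %% b * b + j %% b) * b + k %% b.
have lt_mod x : x %% b < b by rewrite ltn_mod.
have divb x y : y < b -> (x * b + y) %/ b = x.
  by move=> lty; rewrite divnMDl // divn_small // addn0.
have ER : blk_row r = i %% b by rewrite /blk_row !divb.
have EC : blk_col r = j %% b by rewrite /blk_col divb // modnMDl modn_mod.
have EM : blk_mid r = k %% b by rewrite /blk_mid modnMDl modn_mod.
exists r; first by rewrite mem_iota /=; do 2 apply: pair_lt => //.
rewrite /contributes Ei Ej.
rewrite ER EC EM !eqxx /=; apply/hasP; exists (k %/ b).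
  by rewrite mem_iota /= ltn_divLR // (leq_trans (ltn_ord k)).
rewrite /block /row_res /col_res -!divn_eq !ltn_ord /=.
by rewrite !nth_matrix_code Aik Bkj.
Qed.

End Product.

(** * Parameters of the reduction and their computation *)

Definition base_size N d P :=
  2 + 3 * N + 3 * (P * P) + 3 * (P * P * P) + 8 * (P * P * (d * d)).

(** The minimum 4 keeps the segment length positive for small [m], where only correctness
    matters. *)
Definition str_len m := maxn (cbrt_floor m) 4.
Definition seg_len m := (str_len m - 1) %/ 3.
Definition seg_count b m := m %/ (seg_len m * b) + 1.
(** Truncated subtraction: the size [m * m] is reached once the unpadded grammar fits, which holds
    for large [m]. *)
Definition padding b m := m * m - base_size (str_len m) (seg_len m) (seg_count b m).

Definition cbrt_cond : expr := (ve * ve * ve < vm + $1)%M.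
Definition base_expr : expr :=
  ($2 + $3 * vN + $3 * ePP + $3 * (ePP * vP) + $8 * (ePP * edd))%M.

(** A linear scan keeping the last number whose cube is at most [m]; it stays within the quadratic
    budget. *)
Definition cbrt_cmd : cmd :=
  While (ve < vm + $1)%M
    (Seq (If cbrt_cond (Put 4 (Lit 2) ve) Skip) (Put 4 (Lit 0) (ve + $1)%M)).

Definition setup b : cmd :=
  Seq (Put 4 (Lit 0) (Lit 0))
  (Seq cbrt_cmd
  (Seq (If (vN < $4)%M (Put 4 (Lit 2) (Lit 4)) Skip)
  (Seq (Put 4 (Lit 3) ((vN - $1) %/ $3)%M)
  (Seq (Put 4 (Lit 4) (vm %/ (vd * $b) + $1)%M)
       (Put 4 (Lit 5) (vm * vm - base_expr)%M))))).

Definition setup_deg b := 30 + deg cbrt_cond + deg base_expr + b.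

Definition cbrt_upto m i := \max_(k < i | k ^ 3 <= m) k.

Lemma cbrt_upto_lt m i : cbrt_upto m i <= i.-1.
Proof. by apply/bigmax_leqP => k _; have := ltn_ord k; lia. Qed.

Section Setup.
Variables (b D M W m : nat) (inp : store) (out : nat -> nat) (ps : store).
Hypotheses (inp_m : inp 0 0 = m) (inpM : forall a i, a < 3 -> inp a i <= M).
Hypotheses (degD : setup_deg b <= D) (DW : M.+2 ^ D <= W) (mM : m + 4 <= M).

Lemma exec_cbrt :
  exists n, n <= 40 * (m + 2) /\ exec W cbrt_cmd (mk inp [:: 0; 0; 0; 0; 0; 0] out ps)
    (mk inp [:: m.+1; 0; cbrt_floor m; 0; 0; 0] out ps) n.
Proof.
pose St i := mk inp [:: i; 0; cbrt_upto m i; 0; 0; 0] out ps.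
have okD c : c <= 30 -> c <= D by move: degD; rewrite /setup_deg; lia.
have cM i : i <= m.+1 -> all (leq^~ M) [:: i; 0; cbrt_upto m i; 0; 0; 0].
  by move=> le; have := cbrt_upto_lt m i; rewrite /=; lia.
have ev i ex : i <= m.+1 -> pure predT ex -> deg ex <= D ->
    eval W (St i) ex = Some (den inp [:: i; 0; cbrt_upto m i; 0; 0; 0] ex).
  by move=> le pex dex; apply: (eval_pure out ps inpM (cM _ le) pex dex DW).
have evc i : i <= m.+1 -> eval W (St i) (ve < vm + $1)%M = Some (nat_of_bool (i < m.+1)).
  by move=> le; rewrite ev //; [rewrite /= inp_m addn1|apply: okD].
have [i s lti ->|s ->|i s lti ->||s [n [X nle Es]]] :=
  @exec_for W (fun i s => s = St i) (ve < vm + $1)%M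
   (Seq (If cbrt_cond (Put 4 (Lit 2) ve) Skip) (Put 4 (Lit 0) (ve + $1)%M)) m.+1 30
   _ _ _ (mk inp [:: 0; 0; 0; 0; 0; 0] out ps).
- by rewrite evc ?lti // ltnW.
- by rewrite evc // ltnn.
- have lem := ltnW lti.
  have incr c : c <= M -> exec W (Put 4 (Lit 0) (ve + $1)%M) (mk inp [:: i; 0; c; 0; 0; 0] out ps)
      (mk inp [:: i.+1; 0; c; 0; 0; 0] out ps) 6.
    move=> cleM.
    have := @exec_reg D M W inp out inpM DW predT [:: i; 0; c; 0; 0; 0] 0 (ve + $1)%M ps.
    rewrite /= addn1; apply=> //; [by rewrite cleM; lia|exact: okD|exact: okD].
  (* The new candidate [i] is never below the earlier maximum, so overwriting the register computes
     the maximum. *)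
  have cS : cbrt_upto m i.+1 = if i * i * i < m + 1 then i else cbrt_upto m i.
    rewrite /cbrt_upto big_mkcond big_ord_recr /= -big_mkcond -/(cbrt_upto m i).
    have -> : (i ^ 3 <= m) = (i * i * i < m + 1) by rewrite addn1 ltnS !expnS expn0 muln1 mulnA.
    case: ifP => _; last by rewrite maxn0.
    by have := cbrt_upto_lt m i; lia.
  have evs : eval W (St i) cbrt_cond = Some (nat_of_bool (i * i * i < m + 1)).
    by rewrite ev //; [rewrite /= inp_m|move: degD; rewrite /setup_deg; lia].
  have := cM _ lti; rewrite /St cS; move: evs; case: ifP => Hi evs cMS.
    exists (mk inp [:: i.+1; 0; i; 0; 0; 0] out ps), ((4 + ecost cbrt_cond).+1 + 6).
    split=> //; apply: ExecSeq (incr _ _); last by lia.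
    apply: ExecIfTrue evs _ _ => //.
    have := @exec_reg D M W inp out inpM DW predT _ 2 ve ps (cM _ lem).
    by apply=> //; exact: okD.
  exists (mk inp [:: i.+1; 0; cbrt_upto m i; 0; 0; 0] out ps), ((1 + ecost cbrt_cond).+1 + 6).
  split=> //; apply: ExecSeq (incr _ _); last by have := cbrt_upto_lt m i; lia.
  exact: ExecIfFalse evs (ExecSkip _ _).
- by rewrite /St /cbrt_upto big_ord0.
exists n; split; last by move: X; rewrite Es; exact.
by apply: leq_trans nle _; rewrite [ecost _]/=; lia.
Qed.

Lemma exec_setup : seg_count b m <= M -> padding b m <= M ->
  exists n, n <= 300 * (m + 2) /\ exec W (setup b) (mk inp [:: 0; 0; 0; 0; 0; 0] out ps)
    (mk inp [:: m.+1; 0; str_len m; seg_len m; seg_count b m; padding b m] out ps) n.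
Proof.
move=> PM LM; have [n [nle X]] := exec_cbrt.
have okD c : c <= 30 -> c <= D by move: degD; rewrite /setup_deg; lia.
have c_le : cbrt_floor m <= m by apply: cbrt_upto_lt m m.+1.
have NM : str_len m <= M by rewrite /str_len geq_max; lia.
have dM : seg_len m <= M by apply: leq_trans (leq_div _ _) _; lia.
have reg sc i ex v c : all (leq^~ M) sc -> pure predT ex -> deg ex <= D -> i <= 5 ->
    den inp sc ex = v -> (ecost ex).+2 = c ->
    exec W (Put 4 (Lit i) ex) (mk inp sc out ps) (mk inp (set_nth 0 sc i v) out ps) c.
  move=> scM pex dex i5 <- <-; apply: (exec_reg _ inpM DW _ scM pex dex).
  by apply: okD; lia.
have [n3 [n3le X3]] : exists n3, n3 <= 20 /\
    exec W (If (vN < $4)%M (Put 4 (Lit 2) (Lit 4)) Skip)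
      (mk inp [:: m.+1; 0; cbrt_floor m; 0; 0; 0] out ps)
      (mk inp [:: m.+1; 0; str_len m; 0; 0; 0] out ps) n3.
  have scM : all (leq^~ M) [:: m.+1; 0; cbrt_floor m; 0; 0; 0] by rewrite /=; lia.
  have evc : eval W (mk inp [:: m.+1; 0; cbrt_floor m; 0; 0; 0] out ps) (vN < $4)%M =
      Some (nat_of_bool (cbrt_floor m < 4)).
    by rewrite (eval_pure out ps inpM (pr := predT) scM _ _ DW) //; exact: okD.
  rewrite /str_len; case: (ltnP (cbrt_floor m) 4) evc => H evc.
    exists (3 + ecost (vN < $4)%M).+1; split=> //; apply: ExecIfTrue evc _ _ => //.
    by apply: (@reg [:: m.+1; 0; cbrt_floor m; 0; 0; 0] 2 (Lit 4) 4) => //; exact: okD.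
  exists (1 + ecost (vN < $4)%M).+1; split=> //.
  exact: ExecIfFalse evc (ExecSkip _ _).
exists (3 + (n + (n3 + ((ecost ((vN - $1) %/ $3)%M).+2 +
  ((ecost (vm %/ (vd * $b) + $1)%M).+2 + (ecost (vm * vm - base_expr)%M).+2))))).
split; first by rewrite /=; lia.
apply: ExecSeq.
  by apply: (@reg [:: 0; 0; 0; 0; 0; 0] 0 (Lit 0) 0) => //; exact: okD.
apply: ExecSeq X _; apply: ExecSeq X3 _; apply: ExecSeq.
  apply: (@reg _ 3 _ (seg_len m)) => //; last exact: okD.
  by rewrite /= NM; lia.
apply: ExecSeq.
  apply: (@reg _ 4 _ (seg_count b m)) => //=.
  - by rewrite NM dM; lia.
  - by move: degD; rewrite /setup_deg; lia.
  - by rewrite inp_m.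
apply: (@reg _ 5 _ (padding b m)) => //=.
- by rewrite NM dM PM; lia.
- by move: degD; rewrite /setup_deg /=; lia.
- by rewrite inp_m.
Qed.

End Setup.

Definition red_size b m := base_size (str_len m) (seg_len m) (seg_count b m) + padding b m.
(** With all parameters at most [m + 4], the grammar size is at most quartic in [m + 4]; three
    further factors of at least 4 absorb the constants. *)
Definition reg_bound m := (m + 4) ^ 7.

Lemma cbrt_floor_le m : cbrt_floor m <= m.
Proof. exact: cbrt_upto_lt m m.+1. Qed.

Lemma str_len_le m : str_len m <= m + 4.
Proof. by rewrite /str_len geq_max; have := cbrt_floor_le m; lia. Qed.

Lemma seg_len_gt0 m : 0 < seg_len m.
Proof. by rewrite /seg_len divn_gt0 // /str_len; lia. Qed.

Lemma seg_len_lt m : 3 * seg_len m < str_len m.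
Proof.
have := leq_trunc_div (str_len m - 1) 3; rewrite -/(seg_len m) /str_len; lia.
Qed.

Lemma seg_count_le b m : seg_count b m <= m + 4.
Proof. by rewrite /seg_count; have := leq_div m (seg_len m * b); lia. Qed.

Lemma seg_count_mul b m : 0 < b -> m <= seg_count b m * seg_len m * b.
Proof.
move=> b0; rewrite /seg_count -mulnA addn1; apply/ltnW/ltn_ceil.
by rewrite muln_gt0 seg_len_gt0.
Qed.

Lemma reg_bound_ge b m : [/\ 4 + 2 * red_size b m <= reg_bound m, m * m <= reg_bound m & m + 4 <= reg_bound m].
Proof.
have := str_len_le m; have := seg_count_le b m; have := seg_len_lt m.
have padm : padding b m <= m * m by rewrite /padding leq_subr.
rewrite /red_size /base_size; move: (str_len m) (seg_len m) (seg_count b m) (padding b m) padm.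
move=> N d P L Lm dN PX NX; rewrite /reg_bound.
have [X EX] : {X | X = m + 4} by exists (m + 4).
have X4 : 4 <= X by lia.
have mX : m <= X by lia.
rewrite -EX in PX NX *; have dX : d <= X by lia.
have XX : X * X * X * X * 64 <= X ^ 7.
  have -> : X ^ 7 = X * X * X * X * (X * X * X) by rewrite !expnS expn0; lia.
  by rewrite leq_mul2l; apply/orP; right; nia.
have PP : P * P <= X * X by apply: leq_mul.
have PPP : P * P * P <= X * X * X by apply: leq_mul.
have dd : d * d <= X * X by apply: leq_mul.
have PPdd : P * P * (d * d) <= X * X * (X * X) by apply: leq_mul.
have mm : m * m <= X * X by apply: leq_mul.
have x2 : X * 4 <= X * X by rewrite leq_mul2l X4 orbT.
have x3 : X * X * 4 <= X * X * X by rewrite leq_mul2l X4 orbT.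
have x4 : X * X * X * 4 <= X * X * X * X by rewrite leq_mul2l X4 orbT.
by rewrite mulnA in PPdd; split; lia.
Qed.

(** * The algorithm over all residue triples *)

Section Algorithm.
Variables (Q : parser) (k0 q b : nat).
Hypothesis parserQ : forall (G : cfg) (w : seq 'I_(terms G)),
  exists s n F, let W := max_word k0 (parser_input_size w) n in
    [/\ exec W (prep Q) (parser_input w) s n, c_oracle w F
      & serves W q (query Q) w s F].
Hypothesis b0 : 0 < b.
Notation R := (b * b * b).

Definition nth_copy r : cmd :=
  run_copy Q b R (blk_row b r) (blk_col b r) (blk_mid b r) r.

Fixpoint copies r n : cmd :=
  if n is n'.+1 then Seq (nth_copy r) (copies r.+1 n') else Skip.

Definition bmm_cmd : cmd := Seq (setup b) (copies 0 R).

Definition nth_deg r := copy_deg b (blk_row b r) (blk_col b r) (blk_mid b r).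
Definition nth_cost r := copy_cost q b (blk_row b r) (blk_col b r) (blk_mid b r).
Definition nth_contributes inp m n r :=
  contributes b (blk_row b r) (blk_col b r) (blk_mid b r) inp m n.

(** The slices of later copies stay blank because each run leaves all other slices alone. The list
    [ns] collects the preprocessing times, chosen before [W]. *)
Lemma exec_copies (inp : store) m N d P L M D n r :
    inp 0 0 = m -> (forall a i, a < 3 -> inp a i <= M) ->
    0 < d -> 0 < P -> 3 * d < N -> m <= P * d * b ->
    4 + 2 * (base_size N d P + L) <= M -> m * m <= M ->
    (forall r', r' < R -> nth_deg r' <= D) -> r + n <= R ->
  exists ns, [/\ size ns = n, (forall nu, nu \in ns -> prep_time Q (base_size N d P + L) N nu) &
  forall W e0 p0 out ps,
    M.+2 ^ D <= W ->
    (forall nu, nu \in ns -> max_word k0 (num_nonterms P + N + (base_size N d P + L) + N) nu <= W) ->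
    e0 <= M -> p0 <= M ->
    (forall r', r <= r' < R -> slice R r' ps = (fun _ _ => 0)) ->
  exists s' c,
    [/\ exec W (copies r n) (mk inp [:: e0; p0; N; d; P; L] out ps) s' c,
        sumn ns <= c <= sumn ns + sumn (map nth_cost (iota r n)) *
          (5 + 2 * (base_size N d P + L) + m * m) + 1 &
        forall j, s' 3 j = if (j < m * m) &&
          has (fun r' => nth_contributes inp m (P * d) r' j) (iota r n) then 1 else out j]].
Proof.
move=> inp_m inpM d0 P0 dN m_le gM mM degD.
elim: n r => [|n IHn] r leR.
  exists [::]; split=> // W e0 p0 out ps _ _ _ _ _.
  exists (mk inp [:: e0; p0; N; d; P; L] out ps), 1; split=> //; first exact: ExecSkip.
  by move=> j; rewrite andbF.
have ltr : r < R by lia.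
have [ns [sz prepns IH]] := IHn r.+1 ltac:(lia).
have [nu prepnu X] := exec_run_copy parserQ (blk_row b r) (blk_col b r) (blk_mid b r)
  b0 ltr inp_m inpM d0 P0 dN m_le gM mM.
exists (nu :: ns); split; first by rewrite /= sz.
  by move=> nu'; rewrite inE => /orP[/eqP->|/prepns].
move=> W e0 p0 out ps DW nsW e0M p0M psE.
have [|||e1 [p1 [ps' [c1 [X1 c1le e1M p1M O1]]]]] := X W e0 p0 out ps _ _ e0M p0M.
- by apply: leq_trans DW; rewrite leq_exp2l //; apply: degD.
- by apply: nsW; rewrite mem_head.
- by apply: psE; rewrite leqnn.
set out1 := out_upto _ _ _ _ _ _ _ _ out _ in X1.
have [||s' [c2 [X2 c2le O2]]] := IH W e1 p1 out1 ps' DW _ e1M p1M _.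
- by move=> nu' nuin; apply: nsW; rewrite inE nuin orbT.
- move=> r' /andP[lr' ltr']; rewrite O1 //; last by move=> E; rewrite E ltnn in lr'.
  by apply: psE; rewrite ltr' ltnW.
exists s', (c1 + c2); split; first exact: ExecSeq X1 X2.
  pose T := 5 + 2 * (base_size N d P + L) + m * m.
  have {}c1le : nu <= c1 <= nu + nth_cost r * T := c1le.
  move: c1le c2le; rewrite -/T; cbn [map sumn iota foldr].
  rewrite mulnDl; move: (nth_cost r) (sumn _) (sumn _) T => *; lia.
move=> j; rewrite O2 /out1 /out_upto /nth_contributes /=.
by case: (j < m * m) => //=; case: contributes => //=; rewrite ?if_same.
Qed.

Definition bmm_deg := setup_deg b + sumn (map nth_deg (iota 0 R)).
Definition bmm_cost := 300 + sumn (map nth_cost (iota 0 R)).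
Lemma exec_bmm m (A B : 'M[bool]_m) :
  exists ns, [/\ size ns = R,
    (forall nu, nu \in ns -> prep_time Q (red_size b m) (str_len m) nu) &
    forall W, (reg_bound m).+2 ^ bmm_deg <= W ->
      (forall nu, nu \in ns -> max_word k0 (reg_bound m) nu <= W) ->
    exists s c, [/\ exec W bmm_cmd (bmm_input A B) s c,
      sumn ns <= c <= sumn ns + bmm_cost * (8 + 2 * red_size b m + m * m + m) &
      forall i j : 'I_m, s 3 (i * m + j) = bool_mulmx A B i j]].
Proof.
have [gM mM m4M] := reg_bound_ge b m.
set M := reg_bound m in gM mM m4M *.
have inpM a i : a < 3 -> bmm_input A B a i <= M.
  by move/(bmm_input_le A B i)/leq_trans; apply; rewrite geq_max; lia.
have P0 : 0 < seg_count b m by rewrite /seg_count addn1.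
have degD r : r < R -> nth_deg r <= bmm_deg.
  move=> ltr; apply: leq_trans (leq_addl _ _).
  by apply: (allP (@leq_sumn_map _ nth_deg _ (iota 0 R) (leqnn _))); rewrite mem_iota.
have [ns [sz prepns X]] := @exec_copies (bmm_input A B) m (str_len m) (seg_len m)
  (seg_count b m) (padding b m) M bmm_deg R 0 erefl inpM (seg_len_gt0 m) P0
  (seg_len_lt m) (seg_count_mul m b0) gM mM degD (leqnn _).
exists ns; split=> // W DW nsW.
have PM : seg_count b m <= M by apply: leq_trans (seg_count_le b m) m4M.
have LM : padding b m <= M by apply: leq_trans mM; rewrite /padding leq_subr.
have sD : setup_deg b <= bmm_deg by apply: leq_addr.
have [n [nle X1]] := exec_setup (fun=> 0) (fun _ => fun=> 0) (erefl (bmm_input A B 0 0)) inpM sD DW m4M PM LM.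
rewrite -bmm_inputE in X1; have {}nle : n <= 300 * (m + 2) := nle.
have nsW' nu : nu \in ns -> max_word k0 (num_nonterms (seg_count b m) + str_len m +
    (base_size (str_len m) (seg_len m) (seg_count b m) + padding b m) + str_len m) nu <= W.
  move/nsW; apply: leq_trans; rewrite /max_word; case: (k0) => [//|k]; rewrite leq_exp2r //.
  rewrite !leq_add2r; apply: leq_trans gM; rewrite /red_size /base_size /num_nonterms.
  have := @leq_pmulr (seg_count b m * seg_count b m) (seg_len m * seg_len m).
  by rewrite muln_gt0 seg_len_gt0 => /(_ isT); lia.
have [|||s [c [X2 cle O2]]] := X W m.+1 0 (fun=> 0) (fun _ => fun=> 0) DW nsW' _ _ _ => //.
  by lia.
exists s, (n + c); split; first exact: ExecSeq X1 X2.
  move: cle; rewrite -/(red_size b m) /bmm_cost !mulnDl.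
  move: (sumn ns) => u; move: (sumn _) (red_size b m) => v g.
  have : v * (5 + 2 * g + m * m) <= v * (8 + 2 * g + m * m + m) by rewrite leq_mul2l; lia.
  by lia.
move=> i j; rewrite O2 -(contributes_product _ _ b0 i j (seg_count_mul m b0)) /nth_contributes.
have -> : i * m + j < m * m by apply: pair_lt.
by rewrite /=; case: has.
Qed.

Lemma exp_le_mono (x y k l : nat) : 0 < y -> x <= y -> k <= l -> x ^ k <= y ^ l.
Proof.
move=> y0 xy kl; apply: (@leq_trans (y ^ k)); last by rewrite leq_pexp2l.
by case: k {kl} => // k; rewrite leq_exp2r.
Qed.

Lemma exp_le_expM (x y k l : nat) : x <= y ^ k -> x ^ l <= y ^ (k * l).
Proof. by rewrite expnM; case: l => // l; rewrite leq_exp2r. Qed.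

(** A preprocessing time [nu] has no bound in terms of [m], but it is part of the total time [c];
    words polynomial in [nu] are therefore allowed by a bound polynomial in [m + c]. *)
Lemma bmm_cmd_correct : bmm_algorithm bmm_cmd.
Proof.
have := exec_bmm; move: bmm_deg => D bmm.
exists (15 * D + 16 * k0) => m A B; have [ns [_ _ X]] := bmm m A B.
pose W0 := maxn ((reg_bound m).+2 ^ D) (\max_(nu <- ns) max_word k0 (reg_bound m) nu).
have nsW nu : nu \in ns -> max_word k0 (reg_bound m) nu <= W0.
  move=> nuin; apply: leq_trans (leq_maxr _ _); exact: (@leq_bigmax_seq _ _ (fun=> true)).
have [s [c [X1 cle O]]] := X W0 (leq_maxl _ _) nsW.
exists s, c; split=> //; apply: exec_mono X1.
(* From [m + 4 <= (m + 2) ^ 2] come 14 factors; one more absorbs the added 2. *)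
have regM : (reg_bound m).+2 <= (m + 2) ^ 15.
  have le14 : reg_bound m <= (m + 2) ^ 14.
    rewrite /reg_bound (_ : 14 = 2 * 7) // expnM leq_exp2r // -mulnn; nia.
  have ge2 : 2 <= (m + 2) ^ 14 by apply: (@leq_trans (2 ^ 1)) => //; apply: exp_le_mono; lia.
  rewrite expnS; move: (reg_bound m) ((m + 2) ^ 14) le14 ge2 => M y; clear; nia.
have nu_le nu : nu \in ns -> nu <= c.
  move=> nuin; apply: leq_trans (proj1 (andP cle)).
  elim: (ns) nuin => //= x ns' IH; rewrite inE => /orP[/eqP->|/IH]; lia.
rewrite geq_max; apply/andP; split.
  apply: (@leq_trans ((m + 2) ^ (15 * D))).
    exact: exp_le_expM regM.
  by rewrite /max_word; apply: exp_le_mono (leq_addr _ _); lia.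
apply/bigmax_leqP_seq => nu nuin _; have nuc := nu_le _ nuin.
have leZ : reg_bound m + nu + 2 <= (m + c + 2) ^ 16.
  have H : (m + 2) ^ 15 <= (m + c + 2) ^ 15 by apply: exp_le_mono; lia.
  have H1 : m + c + 2 <= (m + c + 2) ^ 15 by apply: leq_trans (exp_le_mono (k := 1) (l := 15) _ (leqnn _) _); rewrite ?expn1 ?addn2.
  have {}H := leq_trans regM H; rewrite expnS.
  have H2 : 2 * (m + c + 2) ^ 15 <= (m + c + 2) * (m + c + 2) ^ 15.
    by rewrite leq_mul2r addn2 orbT.
  move: (reg_bound m) ((m + c + 2) ^ 15) H H1 H2 => M y H H1 H2.
  by apply: leq_trans H2; move: (y) H H1 nuc => z; clear; lia.
apply: (@leq_trans ((m + c + 2) ^ (16 * k0))); first exact: exp_le_expM leZ.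
by rewrite /max_word; apply: exp_le_mono (leqnn _) (leq_addl _ _); rewrite addn2.
Qed.

Lemma bmm_cmd_time m (A B : 'M[bool]_m) W s n : exec W bmm_cmd (bmm_input A B) s n ->
  exists ns, [/\ size ns = R,
    (forall nu, nu \in ns -> prep_time Q (red_size b m) (str_len m) nu) &
    n <= sumn ns + bmm_cost * (8 + 2 * red_size b m + m * m + m)].
Proof.
have [ns [sz prepns X]] := exec_bmm A B.
pose W0 := maxn ((reg_bound m).+2 ^ bmm_deg) (\max_(nu <- ns) max_word k0 (reg_bound m) nu).
have nsW nu : nu \in ns -> max_word k0 (reg_bound m) nu <= W0.
  move=> nuin; apply: leq_trans (leq_maxr _ _); exact: (@leq_bigmax_seq _ _ (fun=> true)).
have [s' [c [X1 /andP[_ cle] _]]] := X W0 (leq_maxl _ _) nsW.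
move=> X2; exists ns; split=> //.
by have [_ ->] := exec_det X2 X1.
Qed.

End Algorithm.

(** * Running time *)

Lemma cbrt_floor_cube m : cbrt_floor m ^ 3 <= m.
Proof.
by apply: (big_ind (fun x => x ^ 3 <= m)) => // x y xm ym; rewrite /maxn; case: ifP.
Qed.

Lemma cbrt_floor_ge k m : k ^ 3 <= m -> k <= cbrt_floor m.
Proof.
move=> km; have lt : k < m.+1 by rewrite ltnS; apply: leq_trans km; rewrite !expnS expn0; nia.
exact: (@leq_bigmax_cond _ (fun i : 'I_m.+1 => i ^ 3 <= m) val (Ordinal lt)).
Qed.

Lemma lt_cbrt_floor_cube m : m < (cbrt_floor m).+1 ^ 3.
Proof. by rewrite ltnNge; apply/negP => /cbrt_floor_ge; rewrite ltnn. Qed.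

(* With [N <= 4 * d] and [P * d * b <= 2 * m], the cubic term [P ^ 3] and the
   quadratic term [(P * d) ^ 2] are small multiples of [m ^ 2]. *)
Lemma base_size_le b m : 32 <= b -> 10 <= cbrt_floor m ->
  base_size (str_len m) (seg_len m) (seg_count b m) <= m * m.
Proof.
move=> b32 c10; have := cbrt_floor_cube m; have := lt_cbrt_floor_cube m.
have EN : str_len m = cbrt_floor m by rewrite /str_len; apply/maxn_idPl; lia.
have d0 := seg_len_gt0 m; have dN := seg_len_lt m; have Nd : str_len m <= 3 * seg_len m + 3.
  have := ltn_ceil (str_len m - 1) (isT : 0 < 3); rewrite -/(seg_len m); lia.
rewrite -EN in c10 *; rewrite !expnS !expn0 !muln1.
have PE : seg_count b m <= m %/ (seg_len m * 32) + 1.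
  by rewrite /seg_count leq_add2r leq_div2l ?leq_mul2l ?b32 ?orbT // muln_gt0 d0.
have := leq_trunc_div m (seg_len m * 32).
move: (str_len m) (seg_len m) (seg_count b m) (m %/ _) c10 d0 dN Nd PE.
move=> {EN b32} N d P r c10 d0 dN Nd PE rm m_lt N_le; rewrite /base_size.
have N4d : N <= 4 * d by lia.
have dm : 32 * d <= m.
  have := leq_mul (leq_mul c10 c10) (leqnn N).
  by rewrite -mulnA; lia.
(* Here [b >= 32] enters: [32 * (P * d) <= m + 32 * d <= 2 * m]. *)
have Pd : 16 * (P * d) <= m.
  have : P * d * 32 <= r * (d * 32) + d * 32.
    by have := leq_mul PE (leqnn (d * 32)); lia.
  by lia.
have PN : 4 * (P * N) <= m by have := leq_mul (leqnn P) N4d; lia.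
have PPdd : 256 * (P * P * (d * d)) <= m * m by have := leq_mul Pd Pd; lia.
(* For [N >= 10], the cube of [N + 1] is at most twice the cube of [N]. *)
have N3 : m <= 2 * (N * (N * N)).
  have : 100 * N <= N * (N * N).
    by have := leq_mul (leq_mul c10 c10) (leqnn N); lia.
  have : 10 * (N * N) <= N * (N * N) by rewrite leq_mul2r c10 orbT.
  by lia.
have m0 : 0 < m by lia.
(* Multiplied by [m], the left side is at most 64 P^3 N^3 = (4 P N)^3 <= m^3. *)
have PPP : 32 * (P * P * P) <= m * m.
  have H1 := leq_mul (leq_mul PN PN) PN.
  have H2 := leq_mul (leqnn (64 * (P * P * P))) N3.
  by rewrite -(leq_pmul2r m0); lia.
have PP : P * P <= P * P * P by case: (P) => // p; rewrite leq_pmulr.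
have Nm : 100 * N <= m.
  by have := leq_mul (leq_mul c10 c10) (leqnn N); lia.
have mm : 1000 * m <= m * m by rewrite leq_mul2r; apply/orP; right; lia.
by lia.
Qed.

Lemma red_size_large b m : 32 <= b -> 10 <= cbrt_floor m -> red_size b m = m * m.
Proof. by move=> b32 c10; rewrite /red_size /padding subnKC // base_size_le. Qed.

Local Open Scope R_scope.

Lemma INR_addn x y : INR (x + y)%N = INR x + INR y.
Proof. exact: plus_INR. Qed.

Lemma INR_muln x y : INR (x * y)%N = INR x * INR y.
Proof. exact: mult_INR. Qed.

Lemma INR_expn x k : INR (x ^ k)%N = INR x ^ k.
Proof. by elim: k => //= k IHk; rewrite expnS INR_muln IHk. Qed.

Lemma INR_leq x y : (x <= y)%N -> INR x <= INR y.
Proof. by move=> H; apply: le_INR; lia. Qed.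

Lemma INR_sumn_le (ns : seq nat) (X : R) :
  (forall nu, nu \in ns -> INR nu <= X) -> INR (sumn ns) <= INR (size ns) * X.
Proof.
elim: ns => [|n ns IHns] H; first by rewrite /=; lra.
have Hn : INR n <= X by apply: H; rewrite mem_head.
have Hs : INR (sumn ns) <= INR (size ns) * X.
  by apply: IHns => nu nuin; apply: H; rewrite inE nuin orbT.
rewrite [sumn _]/= INR_addn [size _]/= S_INR; lra.
Qed.

Section Time.
Variables (Q : parser) (k0 q : nat).
Hypothesis parserQ : forall (G : cfg) (w : seq 'I_(terms G)),
  exists s n F, let W := max_word k0 (parser_input_size w) n in
    [/\ exec W (prep Q) (parser_input w) s n, c_oracle w F
      & serves W q (query Q) w s F].
(* Every run takes at least one step, whereas for a fixed grammar the bound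
   tends to 0 as the string grows. *)
Lemma parser_time_power eps :
  parser_time_O Q (fun g n => INR g * Rpower (INR n) (3 - eps)) -> eps <= 3.
Proof.
case=> C [K [C0 H]]; case: (Rle_dec eps 3) => // eps3; exfalso.
(* A fixed grammar, made large enough for the asymptotic bound by padding of length [K]. *)
have [G [w [_ _ sizeG valw _]]] := @red_grammar 4 1 1 K (fun _ _ _ => true) isT isT isT.
case: w valw => // a w _.
have KG : (K <= cfg_size G)%N by rewrite sizeG; lia.
(* For [n] with n^(eps - 3) >= r, the bound C |G| n^(3 - eps) drops below 1. *)
have [r r1] : exists r, 1 < r /\ C * INR (cfg_size G) < r.
  by exists (Rmax 2 (C * INR (cfg_size G) + 1)); split;
    [have := Rmax_l 2 (C * INR (cfg_size G) + 1)|have := Rmax_r 2 (C * INR (cfg_size G) + 1)]; lra.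
have [n0 n0r] := INR_unbounded (Rpower r (/ (eps - 3))).
pose n := maxn n0 K; have nr : Rpower r (/ (eps - 3)) <= INR n.
  by apply: Rle_trans (Rlt_le _ _ n0r) _; apply: INR_leq; apply: leq_maxl.
have [s [nu [F [X _ _]]]] := parserQ (nseq n a).
have Kn : (K <= size (nseq n a))%N by rewrite size_nseq leq_maxr.
have := H _ _ _ _ _ KG Kn X; rewrite size_nseq.
have nu1 : 1 <= INR nu by apply: (INR_leq (x := 1)); apply: exec_gt0 X.
have rn : r <= Rpower (INR n) (eps - 3).
  have {1}-> : r = Rpower (Rpower r (/ (eps - 3))) (eps - 3).
    by rewrite Rpower_mult Rinv_l ?Rpower_1; lra.
  by apply: Rle_Rpower_l; [lra|split=> //; apply: exp_pos].
have -> : 3 - eps = - (eps - 3) by lra.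
rewrite Rpower_Ropp -Rmult_assoc => le.
have p0 : 0 < Rpower (INR n) (eps - 3) by apply: exp_pos.
have := Rmult_le_compat_r _ _ _ (Rlt_le _ _ p0) (Rle_trans _ _ _ nu1 le).
by rewrite [X in _ <= X]Rmult_assoc Rinv_l; lra.
Qed.

Variable b : nat.
Hypothesis b32 : (32 <= b)%N.

Lemma bmm_time_product (T t : nat -> R) :
  parser_time_O Q (fun g n => T g * t n) ->
  bmm_time_O (bmm_cmd Q b) (fun m =>
    Rmax (INR m ^ 2) (T (m ^ 2)%N * t (cbrt_floor m))).
Proof.
case=> C [K [C0 H]]; have b0 : (0 < b)%N by apply: leq_trans b32.
(* There are b^3 parser runs with constant [C] each, plus the quadratic work of the driver. The
   threshold makes the cube root at least [K] and at least 10. *)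
exists (INR (b * b * b)%N * C + INR (12 * bmm_cost q b)%N + 1), (maxn K 10 ^ 3)%N; split.
  have := pos_INR (b * b * b)%N; have := pos_INR (12 * bmm_cost q b)%N.
  by move=> h1 h2; have := Rmult_le_pos _ _ h2 (Rlt_le _ _ C0); lra.
move=> m A B W s n Km X; have := cbrt_floor_ge Km; rewrite geq_max => /andP[Kc c10].
have cm := cbrt_floor_le m.
have [ns [sz prepns nle]] := bmm_cmd_time parserQ b0 X.
have Em := red_size_large b32 c10; rewrite Em in prepns nle.
have EN : str_len m = cbrt_floor m by rewrite /str_len; apply/maxn_idPl; lia.
rewrite EN in prepns.
set Y := Rmax _ _; have Y1 : INR m ^ 2 <= Y by apply: Rmax_l.
have Y2 : T (m ^ 2)%N * t (cbrt_floor m) <= Y by apply: Rmax_r.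
have nsY : INR (sumn ns) <= INR (b * b * b)%N * (C * Y).
  rewrite -sz; apply: INR_sumn_le => nu /prepns[G [w [W' [s' [Eg Ew Xp]]]]].
  apply: Rle_trans (H G w W' s' nu _ _ Xp) _.
  - by rewrite Eg; apply: leq_trans Kc _; apply: leq_trans cm _; rewrite leq_pmulr //; lia.
  - by rewrite Ew.
  - by rewrite Eg Ew mulnn; apply: Rmult_le_compat_l => //; lra.
have n12 : (n <= sumn ns + 12 * bmm_cost q b * m ^ 2)%N.
  apply: leq_trans nle _; rewrite leq_add2l -mulnn.
  have m10 : (10 <= m)%N by apply: leq_trans c10 cm.
  have : (10 * m <= m * m)%N by rewrite leq_mul2r m10 orbT.
  move=> mm; rewrite [(12 * _)%N]mulnC -mulnA leq_mul2l; apply/orP; right; lia.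
have := INR_leq n12; rewrite INR_addn INR_muln INR_expn.
have c0 := pos_INR (12 * bmm_cost q b)%N.
have : INR (12 * bmm_cost q b)%N * INR m ^ 2 <= INR (12 * bmm_cost q b)%N * Y.
  exact: Rmult_le_compat_l.
have Y0 : 0 <= Y by apply: Rle_trans (pow2_ge_0 _) Y1.
by lra.
Qed.

(** Rounding the cube root down lowers a power only if the exponent is nonnegative; hence the
    interest in [eps <= 3]. *)
Lemma Rpower_cbrt m e : (0 < cbrt_floor m)%N -> 0 <= e ->
  Rpower (INR (cbrt_floor m)) e <= Rpower (INR m) (e / 3).
Proof.
move=> c0 e0; have cR : 0 < INR (cbrt_floor m) by apply: (lt_INR 0); lia.
have -> : Rpower (INR (cbrt_floor m)) e = Rpower (INR (cbrt_floor m) ^ 3) (e / 3).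
  rewrite -Rpower_pow // Rpower_mult; congr Rpower; rewrite /=; lra.
apply: Rle_Rpower_l; first lra.
split; first exact: pow_lt.
by rewrite -INR_expn; apply: INR_leq; apply: cbrt_floor_cube.
Qed.

Lemma bmm_time_power eps : eps <= 3 ->
  parser_time_O Q (fun g n => INR g * Rpower (INR n) (3 - eps)) ->
  bmm_time_O (bmm_cmd Q b) (fun m => Rpower (INR m) (3 - eps / 3)).
Proof.
move=> eps3 /(@bmm_time_product INR (fun n => Rpower (INR n) (3 - eps)))[C [K [C0 H]]].
exists C, (maxn K 1); split=> // m A B W s n; rewrite geq_max => /andP[Km m1] X.
apply: Rle_trans (H m A B W s n Km X) _; apply: Rmult_le_compat_l; first lra.
have mR : 1 <= INR m by apply: (INR_leq (x := 1)).
have m2 : INR m ^ 2 = Rpower (INR m) 2 by rewrite -Rpower_pow //; lra.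
apply: Rmax_lub.
  (* The exponent 2 is at most [3 - eps / 3] exactly because [eps <= 3]. *)
  by rewrite m2; apply: Rle_Rpower; lra.
rewrite INR_expn m2.
have c1 : (0 < cbrt_floor m)%N by apply: cbrt_floor_ge.
apply: Rle_trans (Rmult_le_compat_l _ _ _ _ (Rpower_cbrt c1 _)) _.
- exact: Rlt_le (exp_pos _).
- by lra.
- by rewrite -Rpower_plus; right; congr Rpower; lra.
Qed.

End Time.

Theorem theorem2 :
  forall P : parser, c_parser P ->
  exists M : cmd, bmm_algorithm M /\
    (forall T t : nat -> R,
       parser_time_O P (fun g n => T g * t n) ->
       bmm_time_O M (fun m =>
         Rmax (INR m ^ 2) (T (m ^ 2)%N * t (cbrt_floor m)))) /\
    (forall eps : R,
       parser_time_O P (fun g n => INR g * Rpower (INR n) (3 - eps)) ->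
       bmm_time_O M (fun m => Rpower (INR m) (3 - eps / 3))).
Proof.
move=> P [k [q parserP]]; have b32 : (32 <= 32)%N by [].
exists (bmm_cmd P 32); split; last split.
- exact: bmm_cmd_correct parserP (isT : 0 < 32)%N.
- by move=> T t H; exact: (bmm_time_product parserP b32 H).
- by move=> eps H; apply: (bmm_time_power parserP b32 (parser_time_power parserP H) H).
Qed.
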